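(* For each $c\in\mathbb{N}$, there exist $n_0(c)\in\mathbb{N}$ and $\delta_0(c)>0$ such that the following holds. Let $\mathcal{A}\subset S_n$ with $|\mathcal{A}|=c(n-1)!$, and with $$|\partial\mathcal{A}|\le\frac{|\mathcal{A}|(n!-|\mathcal{A}|)}{(n-1)!}+\delta n|\mathcal{A}|,$$ where $n\ge n_0(c)$ and $\delta\le\delta_0(c)$. Then there exists a family $\mathcal{B}\subset S_n$ such that $\mathcal{B}$ is a union of $c$ 1-cosets of $S_n$, and $$|\mathcal{A}\setminus\mathcal{B}|\le O(c\delta)(n-1)!+O(c^2)(n-2)!.$$ (One may take $\delta_0(c)=\Omega(c^{-4})$ and $n_0(c)=O(c^2)$.)
   Context: $S_n$ is the symmetric group on $[n]=\{1,\dots,n\}$. For $i,j\in[n]$, $T_{ij}=\{\sigma\in S_n:\sigma(i)=j\}$; the sets $T_{ij}$ are called the 1-cosets of $S_n$. A union of 1-cosets need not be disjoint. The transposition graph on $S_n$ is the Cayley graph on $S_n$ generated by the transpositions (vertices $S_n$, with $\sigma$ joined to $\sigma\tau$ for every transposition $\tau$). For $\mathcal{A}\subset S_n$, $\partial\mathcal{A}$ denotes the edge-boundary of $\mathcal{A}$ in the transposition graph, i.e. the set of edges between $\mathcal{A}$ and $S_n\setminus\mathcal{A}$. The notation $u=O(v)$ means $|u|\le C|v|$ pointwise for an absolute constant $C$ (not depending on any of the variables $n,c,\delta,\mathcal{A}$), and $u=\Omega(v)$ means $|u|\ge C|v|$ pointwise for an absolute constant $C>0$. *)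

(* Defs.v *)
From mathcomp Require Import all_boot all_fingroup.

Set Implicit Arguments.
Unset Strict Implicit.
Unset Printing Implicit Defensive.

Definition one_coset (n : nat) (i j : 'I_n) : {set 'S_n} :=
  [set s : 'S_n | s i == j].

Definition one_cosets (n : nat) : {set {set 'S_n}} :=
  [set one_coset i j | i : 'I_n, j : 'I_n].

(* The [c] cosets are distinct as sets; they need not be disjoint. *)
Definition union_of_one_cosets (n c : nat) (B : {set 'S_n}) : Prop :=
  exists F : {set {set 'S_n}},
    [/\ F \subset one_cosets n, #|F| = c & B = cover F].

Definition transpositions (n : nat) : {set 'S_n} :=
  [set tperm p.1 p.2 | p : 'I_n * 'I_n & p.1 != p.2].

Definition cayley_graph (gT : finGroupType) (S : {set gT}) : rel gT :=
  fun s t => [exists u in S, t == (s * u)%g].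

(* In 'S_n the product [s * u] is "first s, then u". The opposite convention
   gives the same graph, as transpositions are closed under conjugation. *)
Definition transposition_graph (n : nat) : rel 'S_n :=
  cayley_graph (transpositions n).

(* Edges are unordered pairs [set x; y]. *)
Definition edge_boundary (T : finType) (e : rel T) (A : {set T}) :
  {set {set T}} :=
  [set [set x; y] | x in A, y in ~: A & e x y].

(* Main.v *)
Require Import Defs.
From mathcomp Require Import all_boot all_order all_algebra all_fingroup.
From mathcomp Require Import reals.
From mathcomp Require Import ring lra.
Import Order.TTheory GRing.Theory Num.Theory.
Local Open Scope ring_scope.

Set Implicit Arguments.
Unset Strict Implicit.
Unset Printing Implicit Defensive.

(** Write [f] for the indicator of [A], [E] for the mean over the symmetric
    group, [b i j] for the density of [A] in the 1-coset of the permutations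
    sending [i] to [j], minus the density [c/n] of [A], and [X] for the sum of
    the [b i j ^ 2].  The proof has a spectral half, showing that [X] is almost
    as large as it can be, namely [c], and a rigidity half, deducing that the
    matrix [b] is almost a 0-1 matrix with [c] ones.

    Spectral half.  The Laplacian of the transposition graph multiplies by [n]
    every permutation statistic [s |-> sum_i b i (s i)] whose matrix has zero
    row and column sums, and it is at least [2n-2] on the functions having zero
    mean on every 1-coset ([second_level_gap]).  The hypothesis says that the
    Laplacian form of [f] is hardly more than [n] times the variance of [f], so
    almost all the variance comes from the projection of [f] to the statistics,
    whose squared norm is [X/n] to leading order: [X >= c - O(c delta + c^2/n)].
    The bound [2n-2] is proved by induction on [n].  The permutations with
    [s k = j] form a copy of the symmetric group of degree [n-1], and the form
    of [f] is an average of the forms of its restrictions to these copies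
    ([dirichlet_lift]).  The induction hypothesis applies to the restrictions
    up to their own level-one parts, which together are controlled by the
    correlations of [f] with the events [s i = j, s k = m]; Bessel's inequality
    against the statistic [sum_(i, k) w i (s i) k (s k)] built from these
    correlations shows that this loss is affordable ([pair_energy_le]).

    Rigidity half.  A second moment cannot distinguish [c] entries equal to 1
    from many small entries with the same [X].  A fourth moment can: for
    [G s = sum_i b i (s i)] one has [n E G^4 <= sum b^4 + O(X^2/n)]
    ([permstat_fourth_moment]), so spread-out entries contribute nothing to
    first order.  On the other hand [G^4 >= f (4 G - 3)] pointwise because [f]
    is 0-1 valued, and [n E(f G) = X], so [sum b^4 >= 4 X - 3 c - O(c^2/n)].
    With the lower bound on [X] this makes [sum b^2 (1 - b^2)] of order
    [c delta + c^2/n].  When that is small enough exactly [c] entries have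
    [b^2 >= 1/2], and they carry all but the same order of the mass of [A]
    ([rounding]).  The corresponding [c] cosets overlap pairwise in at most
    [(n-2)!] permutations, so their union contains almost all of [A].

    Every moment is computed from a single remark: exchanging the values of a
    uniform permutation at two positions leaves it uniform
    ([permstat_stein]). *)

(** * Means over the symmetric group *)

Section Mean.
Context {R : realFieldType}.

Definition mean n (F : 'S_n -> R) : R := (n`!)%:R^-1 * \sum_s F s.

Section MeanTheory.
Context {n : nat}.
Implicit Types F H : 'S_n -> R.

Lemma natr_fact_gt0 : 0 < (n`!)%:R :> R.
Proof. by rewrite ltr0n fact_gt0. Qed.

Lemma eq_mean F H : (forall s, F s = H s) -> mean F = mean H.
Proof. by move=> FH; congr (_ * _); apply: eq_bigr. Qed.

Lemma meanD F H : mean (fun s => F s + H s) = mean F + mean H.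
Proof. by rewrite /mean big_split mulrDr. Qed.

Lemma meanZ c F : mean (fun s => c * F s) = c * mean F.
Proof. by rewrite /mean -mulr_sumr mulrCA. Qed.

Lemma meanN F : mean (fun s => - F s) = - mean F.
Proof. by rewrite /mean sumrN mulrN. Qed.

Lemma meanB F H : mean (fun s => F s - H s) = mean F - mean H.
Proof. by rewrite meanD meanN. Qed.

Lemma mean_sum (I : Type) (r : seq I) (P : pred I) (F : I -> 'S_n -> R) :
  mean (fun s => \sum_(i <- r | P i) F i s) =
  \sum_(i <- r | P i) mean (F i).
Proof. by rewrite /mean exchange_big mulr_sumr. Qed.

Lemma mean_cst c : mean (fun _ : 'S_n => c) = c.
Proof.
rewrite /mean sumr_const card_Sn -[c *+ _]mulr_natl mulrA mulVf ?mul1r //.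
exact: lt0r_neq0 natr_fact_gt0.
Qed.

Lemma ler_mean F H : (forall s, F s <= H s) -> mean F <= mean H.
Proof.
by move=> FH; rewrite ler_pM2l ?invr_gt0 ?natr_fact_gt0 //; apply: ler_sum.
Qed.

Lemma mean_ge0 F : (forall s, 0 <= F s) -> 0 <= mean F.
Proof. by move=> F0; rewrite -(mean_cst 0); apply: ler_mean. Qed.

(** Invariance of the uniform measure under exchanging the values at two
    positions: the source of every moment computation below. *)
Lemma mean_tperm i k F : mean (fun s => F (tperm i k * s)%g) = mean F.
Proof. by rewrite /mean [in RHS](reindex_inj (mulgI (tperm i k))). Qed.

End MeanTheory.

Lemma tperm_mulL n (i k : 'I_n) (s : 'S_n) : (tperm i k * s)%g i = s k.
Proof. by rewrite permM tpermL. Qed.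

Lemma tperm_mulR n (i k : 'I_n) (s : 'S_n) : (tperm i k * s)%g k = s i.
Proof. by rewrite permM tpermR. Qed.

Lemma tperm_mulD n (i k a : 'I_n) (s : 'S_n) :
  i != a -> k != a -> (tperm i k * s)%g a = s a.
Proof. by move=> ia ka; rewrite permM tpermD. Qed.

(** * Permutation statistics and their moments *)

Definition permstat n (b : 'I_n -> 'I_n -> R) (s : 'S_n) : R :=
  \sum_i b i (s i).

Definition balanced n (b : 'I_n -> 'I_n -> R) : Prop :=
  (forall i, \sum_j b i j = 0) /\ (forall j, \sum_i b i j = 0).

Section Permstat.
Context {n : nat}.
Implicit Types b e : 'I_n -> 'I_n -> R.

Lemma sum_perm (F : 'I_n -> R) (s : 'S_n) : \sum_k F (s k) = \sum_j F j.
Proof. by rewrite [RHS](reindex_inj (@perm_inj _ s)). Qed.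

Lemma sum_off2 (i k : 'I_n) (F : 'I_n -> R) : i != k ->
  \sum_(a | (a != i) && (a != k)) F a = \sum_a F a - F i - F k.
Proof.
move=> ik; have ki : k != i by rewrite eq_sym.
by rewrite [\sum_a F a](bigD1 i) // [in RHS](bigD1 k) //=; ring.
Qed.

Lemma permstat_tperm b i k s :
  permstat b (tperm i k * s)%g =
  permstat b s + (b i (s k) + b k (s i) - b i (s i) - b k (s k)).
Proof.
rewrite /permstat; have [->|ik] := eqVneq i k.
  by rewrite tperm1 mul1g; ring.
have kP : k != i by rewrite eq_sym.
rewrite (bigD1 i) // (bigD1 k) //= tperm_mulL tperm_mulR.
rewrite [in RHS](bigD1 i) // [in RHS](bigD1 k) //=.
rewrite (eq_bigr (fun a => b a (s a))); last first.
  by move=> a /andP[ai ak]; rewrite tperm_mulD // eq_sym.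
by ring.
Qed.

(** Integration by parts: the swap of positions [i] and [k] turns the factor
    [b i (s i)] into [b i (s k)].  When [b] has zero row and column sums, every
    term whose other factors depend on at most one of [i] and [k] then
    vanishes. *)
Lemma permstat_stein b (phi : 'S_n -> R) :
  n%:R * mean (fun s => permstat b s * phi s) =
  mean (fun s => \sum_i \sum_k b i (s k) * phi (tperm i k * s)%g).
Proof.
under [RHS]eq_mean do rewrite exchange_big /=.
rewrite mean_sum.
rewrite (eq_bigr (fun=> mean (fun s => permstat b s * phi s))).
  by rewrite sumr_const card_ord mulr_natl.
move=> k _; rewrite mean_sum.
under eq_mean do rewrite /permstat mulr_suml.
rewrite mean_sum; apply: eq_bigr => i _.
rewrite -[RHS](mean_tperm i k); apply: eq_mean => s.
by rewrite tperm_mulL.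
Qed.

(** The mean of a quantity summed over all ordered pairs of positions.  In the
    computations below a typical term depends on the four entries at the rows
    [i], [k] and the columns [s i], [s k]. *)
Definition dmean (F : 'I_n -> 'I_n -> 'S_n -> R) : R :=
  mean (fun s => \sum_i \sum_k F i k s).

Implicit Types F H : 'I_n -> 'I_n -> 'S_n -> R.

Lemma dmeanE F : dmean F = \sum_i \sum_k mean (F i k).
Proof. by rewrite /dmean mean_sum; under eq_bigr do rewrite mean_sum. Qed.

Lemma eq_dmean F H : (forall i k s, F i k s = H i k s) -> dmean F = dmean H.
Proof.
move=> FH; apply: eq_mean => s.
by apply: eq_bigr => i _; apply: eq_bigr => k _.
Qed.

Lemma dmeanD F H : dmean (fun i k s => F i k s + H i k s) = dmean F + dmean H.
Proof.
rewrite /dmean -meanD; apply: eq_mean => s.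
by rewrite -big_split; apply: eq_bigr => i _; rewrite -big_split.
Qed.

Lemma dmeanZ c F : dmean (fun i k s => c * F i k s) = c * dmean F.
Proof.
rewrite /dmean -meanZ; apply: eq_mean => s.
by rewrite mulr_sumr; apply: eq_bigr => i _; rewrite mulr_sumr.
Qed.

Lemma dmeanN F : dmean (fun i k s => - F i k s) = - dmean F.
Proof. by rewrite -mulN1r -dmeanZ; apply: eq_dmean => i k s; rewrite mulN1r. Qed.

Lemma ler_dmean F H :
  (forall i k s, F i k s <= H i k s) -> dmean F <= dmean H.
Proof.
move=> FH; apply: ler_mean => s.
by apply: ler_sum => i _; apply: ler_sum => k _.
Qed.

Lemma dmean_tperm F :
  dmean (fun i k s => F i k (tperm i k * s)%g) = dmean F.
Proof.
rewrite !dmeanE; apply: eq_bigr => i _; apply: eq_bigr => k _.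
exact: mean_tperm.
Qed.

Lemma dmean_sym F : dmean (fun i k s => F k i s) = dmean F.
Proof. by apply: eq_mean => s; rewrite exchange_big. Qed.

Lemma dmean_row F b (phi : 'I_n -> 'S_n -> R) : balanced b ->
  (forall i k s, F i k s = phi i s * b i (s k)) -> dmean F = 0.
Proof.
move=> [b0 _] FE; rewrite (eq_dmean FE) /dmean -[RHS](mean_cst (n := n)).
apply: eq_mean => s; rewrite big1 // => i _.
by rewrite -mulr_sumr sum_perm b0 mulr0.
Qed.

Lemma dmean_col F b (phi : 'I_n -> 'S_n -> R) : balanced b ->
  (forall i k s, F i k s = phi k s * b i (s k)) -> dmean F = 0.
Proof.
move=> [_ b0] FE; rewrite (eq_dmean FE) /dmean -[RHS](mean_cst (n := n)).
apply: eq_mean => s; rewrite exchange_big big1 // => k _.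
by rewrite -mulr_sumr b0 mulr0.
Qed.

Lemma dmean_cell b (phi : 'S_n -> R) :
  dmean (fun i k s => b i (s k) * phi s) = (\sum_i \sum_j b i j) * mean phi.
Proof.
rewrite -meanZ; apply: eq_mean => s; rewrite mulr_suml; apply: eq_bigr => i _.
by rewrite -mulr_suml sum_perm.
Qed.

Lemma dmean_diag b e :
  dmean (fun i k s => b i (s i) * e k (s k)) =
  mean (fun s => permstat b s * permstat e s).
Proof.
apply: eq_mean => s; rewrite /permstat mulr_suml; apply: eq_bigr => i _.
by rewrite mulr_sumr.
Qed.

Lemma dmean_cross b e :
  dmean (fun i k s => b i (s k) * e k (s i)) =
  mean (fun s => permstat b s * permstat e s).
Proof.
rewrite -dmean_diag -dmean_tperm; apply: eq_dmean => i k s.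
by rewrite tperm_mulL tperm_mulR.
Qed.

Lemma mean_permstat b :
  n%:R * mean (permstat b) = \sum_i \sum_j b i j.
Proof.
rewrite (eq_mean (H := fun s => permstat b s * 1)); last by move=> s; rewrite mulr1.
rewrite permstat_stein -/(dmean _) dmean_cell.
by rewrite mean_cst mulr1.
Qed.

Lemma mean_permstat_balanced b : balanced b -> mean (permstat b) = 0.
Proof.
case: (posnP n) => [n0 _|n_gt0 [b0 _]].
  rewrite -[RHS](mean_cst (n := n)); apply: eq_mean => s.
  by rewrite /permstat big1 // => i; have := ltn_ord i; rewrite {2}n0.
apply/eqP; have := mean_permstat b; rewrite big1 // => /eqP.
by rewrite mulf_eq0 pnatr_eq0 gtn_eqF.
Qed.

(** Only one of the two matrices needs zero sums; taking for [e] an elementary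
    matrix or a power of [b] gives all the second-order moments required. *)
Lemma permstat_cov b e : balanced b ->
  (n%:R - 1) * mean (fun s => permstat b s * permstat e s) =
  \sum_i \sum_j b i j * e i j.
Proof.
move=> bb; rewrite mulrBl mul1r permstat_stein -/(dmean _).
rewrite (eq_dmean (H := fun i k s => permstat e s * b i (s k) +
   (b i (s k) * e i (s k) * 1 + (b i (s k) * e k (s i)
     + (- (e i (s i) * b i (s k)) + - (e k (s k) * b i (s k))))))); last first.
  by move=> i k s; rewrite permstat_tperm; ring.
rewrite !dmeanD !dmeanN dmean_cross (dmean_cell (fun i j => b i j * e i j) (fun=> 1)).
rewrite mean_cst (dmean_row (b := b) (phi := fun _ s => permstat e s)) //.
rewrite (dmean_row (b := b) (phi := fun i s => e i (s i))) //.
rewrite (dmean_col (b := b) (phi := fun k s => e k (s k))) //.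
by ring.
Qed.

(** For a nonnegative matrix nothing cancels, but the two terms removed by the
    swap come with a minus sign and can be dropped. *)
Lemma permstat_sqr_bound b : (forall i j, 0 <= b i j) ->
  (n%:R - 1) * mean (fun s => permstat b s * permstat b s) <=
  (\sum_i \sum_j b i j) * mean (permstat b) + \sum_i \sum_j b i j * b i j.
Proof.
move=> b_ge0; rewrite mulrBl mul1r permstat_stein -/(dmean _).
rewrite lerBlDr -addrA -[X in _ <= _ + (_ + X)](dmean_cross b b).
rewrite -(dmean_cell b).
rewrite -[\sum_i \sum_j b i j * b i j]mulr1 -(mean_cst (n := n) 1).
rewrite -(dmean_cell (fun i j => b i j * b i j)) -!dmeanD.
apply: ler_dmean => i k s; rewrite permstat_tperm.
have := mulr_ge0 (b_ge0 i (s k)) (b_ge0 i (s i)).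
have := mulr_ge0 (b_ge0 i (s k)) (b_ge0 k (s k)).
by lra.
Qed.


Lemma sum_sqr_le_sqr_sum (I : finType) (F : I -> R) :
  (forall i, 0 <= F i) -> \sum_i F i ^+ 2 <= (\sum_i F i) ^+ 2.
Proof.
move=> F0; rewrite expr2 mulr_suml; apply: ler_sum => i _.
by rewrite expr2 ler_wpM2l // (bigD1 i) //= lerDl sumr_ge0.
Qed.

(** The algebra of the fourth moment.  With [g] the statistic and
    [u, v, x, y] the entries at [(i, s k)], [(k, s i)], [(i, s i)], [(k, s k)],
    the terms of the first group average to zero, those of the second are
    evaluated exactly, and all others are dominated, by the inequality of
    arithmetic and geometric means, by products of two squares.  Products such
    as [u^3 x] or [u x^3] may not be so dominated: they would produce a second
    copy of the main term [sum b^4]. *)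
Lemma quartic_expansion_bound (g u v x y : R) :
  u * (g + (u + v - x - y)) ^+ 3 <=
    (u * g ^+ 3 - 3 * (u * x * g ^+ 2) - 3 * (u * y * g ^+ 2)
     + 3 * (g * u ^+ 3) + 3 * (u * x ^+ 2 * g) + 3 * (u * y ^+ 2 * g)
     - 3 * (u ^+ 3 * x) - 3 * (u ^+ 3 * y) - u * x ^+ 3 - u * y ^+ 3)
    + (u ^+ 4 + 3 * (u ^+ 3 * v) + u * v ^+ 3)
    + (17 * (u ^+ 2 * g ^+ 2) + 3 * (v ^+ 2 * g ^+ 2)
       + 26 * (u ^+ 2 * v ^+ 2 + u ^+ 2 * x ^+ 2 + u ^+ 2 * y ^+ 2
               + v ^+ 2 * x ^+ 2 + v ^+ 2 * y ^+ 2 + x ^+ 2 * y ^+ 2)).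
Proof.
pose w := v - x - y.
have h1 := sqr_ge0 (g * u - g * v).
have h2 := sqr_ge0 (u * g - u * w).
have h3 := sqr_ge0 (v * g - v * u).
have h4 := sqr_ge0 (g * u + v * x); have h4' := sqr_ge0 (g * u + v * y).
have h5 := sqr_ge0 (g * u - x * y).
have h6 := sqr_ge0 (v * u + v * x); have h6' := sqr_ge0 (v * u + v * y).
have h7 := sqr_ge0 (x * u - x * v); have h7' := sqr_ge0 (y * u - y * v).
have h8 := sqr_ge0 (u * v - x * y).
have h9 := sqr_ge0 (x * u + x * y); have h9' := sqr_ge0 (y * u + y * x).
have w1 := sqr_ge0 (u * (v + x)); have w2 := sqr_ge0 (u * (v + y)).
have w3 := sqr_ge0 (u * (x - y)).
have p1 := sqr_ge0 (u * g); have p2 := sqr_ge0 (v * g).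
have p3 := sqr_ge0 (u * v); have p4 := sqr_ge0 (u * x).
have p5 := sqr_ge0 (u * y); have p6 := sqr_ge0 (v * x).
have p7 := sqr_ge0 (v * y); have p8 := sqr_ge0 (x * y).
rewrite /w in h2.
lra.
Qed.


Lemma dmean_same_row d e :
  n%:R * dmean (fun i k s => d i (s i) * e i (s k)) =
  \sum_i (\sum_j d i j) * (\sum_j e i j).
Proof.
rewrite (_ : dmean _ = mean (permstat (fun i j => d i j * \sum_m e i m))).
  by rewrite mean_permstat; apply: eq_bigr => i _; rewrite mulr_suml.
apply: eq_mean => s; apply: eq_bigr => i _.
by rewrite -mulr_sumr sum_perm.
Qed.

Lemma dmean_same_col d e :
  n%:R * dmean (fun i k s => d k (s k) * e i (s k)) =
  \sum_j (\sum_i d i j) * (\sum_i e i j).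
Proof.
rewrite (_ : dmean _ = mean (permstat (fun k j => d k j * \sum_i e i j))).
  by rewrite mean_permstat exchange_big; apply: eq_bigr => j _; rewrite mulr_suml.
apply: eq_mean => s; rewrite exchange_big; apply: eq_bigr => k _.
by rewrite -mulr_sumr.
Qed.

Section FourthMoment.
Variable b : 'I_n -> 'I_n -> R.
Hypotheses (n_gt1 : (1 < n)%N) (bb : balanced b).
Let X := \sum_i \sum_j b i j ^+ 2.
Let X4 := \sum_i \sum_j b i j ^+ 4.
Let G := permstat b.

Let n_ge2 : 2 <= n%:R :> R. Proof. by rewrite ler_nat. Qed.
Let n_gt0 : 0 < n%:R :> R. Proof. by have := n_ge2; lra. Qed.

Let X_ge0 : 0 <= X.
Proof. by do 2![apply: sumr_ge0 => ? _]; apply: sqr_ge0. Qed.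

Let X4_ge0 : 0 <= X4.
Proof.
by do 2![apply: sumr_ge0 => ? _]; rewrite (exprM _ 2 2); apply: sqr_ge0.
Qed.

Let row_sqr_sum : \sum_i (\sum_j b i j ^+ 2) ^+ 2 <= X ^+ 2.
Proof.
by apply: sum_sqr_le_sqr_sum => i; apply: sumr_ge0 => j _; apply: sqr_ge0.
Qed.

Let col_sqr_sum : \sum_j (\sum_i b i j ^+ 2) ^+ 2 <= X ^+ 2.
Proof.
rewrite /X exchange_big.
by apply: sum_sqr_le_sqr_sum => j; apply: sumr_ge0 => i _; apply: sqr_ge0.
Qed.

Let X4_le : X4 <= X ^+ 2.
Proof.
apply: le_trans row_sqr_sum; apply: ler_sum => i _.
rewrite (eq_bigr (fun j => (b i j ^+ 2) ^+ 2)); last by move=> j _; rewrite -exprM.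
by apply: sum_sqr_le_sqr_sum => j; apply: sqr_ge0.
Qed.

Let mean_G2 : (n%:R - 1) * mean (fun s => G s ^+ 2) = X.
Proof.
rewrite (eq_mean (H := fun s => G s * G s)) => [|s]; last by rewrite expr2.
by rewrite permstat_cov //; do 2![apply: eq_bigr => ? _]; rewrite expr2.
Qed.

Let mean_h2 :
  n%:R * mean (fun s => permstat (fun i j => b i j ^+ 2) s *
                        permstat (fun i j => b i j ^+ 2) s) <= 3 * X ^+ 2.
Proof.
have := permstat_sqr_bound (b := fun i j => b i j ^+ 2) (fun _ _ => sqr_ge0 _).
have := mean_permstat (fun i j => b i j ^+ 2).
rewrite -/X (_ : \sum_i \sum_j _ = X4) => [|]; last first.
  by do 2![apply: eq_bigr => ? _]; rewrite -exprD.
set h := mean _; set H := mean _ => nh.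
have := X4_le; have := n_ge2; set N : R := n%:R in nh *; have := n_gt0; rewrite -/N.
move=> N0 N2 h4 hH.
have N1 : 0 < N - 1 by lra.
rewrite -(ler_pM2l N1).
have -> : (N - 1) * (N * H) = N * ((N - 1) * H) by ring.
apply: (le_trans (y := N * (X * h + X4))); first by rewrite ler_pM2l.
have -> : N * (X * h + X4) = X ^+ 2 + N * X4.
  by rewrite mulrDr mulrCA nh; ring.
have : N * X4 <= N * X ^+ 2 by rewrite ler_pM2l.
have := mulr_ge0 (_ : 0 <= N - 2) (sqr_ge0 X).
by move=> /(_ ltac:(lra)); lra.
Qed.

Let quad := dmean (fun i k s =>
  (17 * (b i (s k) ^+ 2 * G s ^+ 2) + 3 * (b k (s i) ^+ 2 * G s ^+ 2)
   + 26 * (b i (s k) ^+ 2 * b k (s i) ^+ 2 + b i (s k) ^+ 2 * b i (s i) ^+ 2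
           + b i (s k) ^+ 2 * b k (s k) ^+ 2 + b k (s i) ^+ 2 * b i (s i) ^+ 2
           + b k (s i) ^+ 2 * b k (s k) ^+ 2 + b i (s i) ^+ 2 * b k (s k) ^+ 2))).

Let quad_bound : n%:R * quad <= 300 * X ^+ 2.
Proof.
pose b2 i j := b i j ^+ 2.
pose Q1 := dmean (fun i k s => b2 i (s k) * G s ^+ 2).
pose Q2 := mean (fun s => permstat b2 s * permstat b2 s).
pose Q3 := dmean (fun i k s => b2 i (s i) * b2 i (s k)).
pose Q4 := dmean (fun i k s => b2 k (s k) * b2 i (s k)).
have -> : quad = 20 * Q1 + 52 * Q2 + 52 * Q3 + 52 * Q4.
  have q1 : dmean (fun i k s => b2 k (s i) * G s ^+ 2) = Q1.
    exact: (dmean_sym (fun i k s => b2 i (s k) * G s ^+ 2)).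
  have q2 : dmean (fun i k s => b2 i (s k) * b2 k (s i)) = Q2.
    exact: dmean_cross.
  have q2' : dmean (fun i k s => b2 i (s i) * b2 k (s k)) = Q2.
    exact: dmean_diag.
  have q3 : dmean (fun i k s => b2 k (s k) * b2 k (s i)) = Q3.
    exact: (dmean_sym (fun i k s => b2 i (s i) * b2 i (s k))).
  have q4 : dmean (fun i k s => b2 i (s i) * b2 k (s i)) = Q4.
    exact: (dmean_sym (fun i k s => b2 k (s k) * b2 i (s k))).
  rewrite /quad (eq_dmean (H := fun i k s =>
    17 * (b2 i (s k) * G s ^+ 2) + (3 * (b2 k (s i) * G s ^+ 2) +
    26 * (b2 i (s k) * b2 k (s i) + (b2 i (s i) * b2 i (s k) +
    (b2 k (s k) * b2 i (s k) + (b2 i (s i) * b2 k (s i) +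
    (b2 k (s k) * b2 k (s i) + b2 i (s i) * b2 k (s k)))))))));
    last by move=> i k s; rewrite /b2; ring.
  rewrite dmeanD dmeanZ dmeanD dmeanZ dmeanZ !dmeanD q1 q2 q2' q3 q4 -/Q1 -/Q3 -/Q4.
  by ring.
have b3 : n%:R * Q3 <= X ^+ 2.
  by rewrite dmean_same_row; apply: le_trans row_sqr_sum; apply: ler_sum => i _.
have b4 : n%:R * Q4 <= X ^+ 2.
  by rewrite dmean_same_col; apply: le_trans col_sqr_sum; apply: ler_sum => i _.
have b1 : n%:R * Q1 <= 2 * X ^+ 2.
  rewrite /Q1 dmean_cell -/X mulrCA.
  have m0 : 0 <= mean (fun s => G s ^+ 2) by apply: mean_ge0 => s; apply: sqr_ge0.
  have : n%:R * mean (fun s => G s ^+ 2) <= 2 * X.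
    rewrite -mean_G2; have := mulr_ge0 (_ : 0 <= n%:R - 2) m0.
    by move=> /(_ ltac:(rewrite subr_ge0; exact: n_ge2)); lra.
  by move=> /(ler_wpM2l X_ge0); lra.
have := mean_h2; rewrite -/Q2; move: b1 b3 b4.
set N := n%:R; rewrite !mulrDr ![N * (_ * _)]mulrCA; lra.
Qed.

(** The coefficient 1 of [sum b^4] is essential: it is compared below with the
    bound [sum b^2 <= c], and a larger constant would leave room for entries
    that are bounded away from both 0 and 1. *)
Lemma permstat_fourth_moment :
  n%:R * mean (fun s => permstat b s ^+ 4) <=
  \sum_i \sum_j b i j ^+ 4
  + 308 * (\sum_i \sum_j b i j ^+ 2) ^+ 2 / n%:R.
Proof.
rewrite -/X -/X4 -/G (eq_mean (H := fun s => G s * G s ^+ 3)); last first.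
  by move=> s; rewrite -exprS.
rewrite permstat_stein -/(dmean _).
pose van i k (s : 'S_n) := b i (s k) * G s ^+ 3 + (- 3 * (b i (s k) * b i (s i) * G s ^+ 2)
  + (- 3 * (b i (s k) * b k (s k) * G s ^+ 2) + (3 * (b i (s k) ^+ 3 * G s) +
  (3 * (b i (s k) * b i (s i) ^+ 2 * G s) + (3 * (b i (s k) * b k (s k) ^+ 2 * G s)
  + (- 3 * (b i (s k) ^+ 3 * b i (s i)) + (- 3 * (b i (s k) ^+ 3 * b k (s k))
  + (- (b i (s k) * b i (s i) ^+ 3) + - (b i (s k) * b k (s k) ^+ 3))))))))).
pose main i k (s : 'S_n) := b i (s k) ^+ 4 * 1
  + (3 * (b i (s k) ^+ 3 * b k (s i)) + b i (s k) * b k (s i) ^+ 3).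
apply: (le_trans (y := dmean van + (dmean main + quad))).
  rewrite -!dmeanD; apply: ler_dmean => i k s.
  rewrite /= /G permstat_tperm -/G.
  apply: le_trans (quartic_expansion_bound _ _ _ _ _) _.
  by rewrite /van /main; lra.
have -> : dmean van = 0.
  rewrite /van dmeanD !(dmeanD, dmeanZ, dmeanN).
  rewrite (dmean_row (b := b) (phi := fun _ s => G s ^+ 3)) //; last by move=> *; ring.
  rewrite (dmean_row (b := b) (phi := fun i s => b i (s i) * G s ^+ 2)) //; last by move=> *; ring.
  rewrite (dmean_col (b := b) (phi := fun k s => b k (s k) * G s ^+ 2)) //; last by move=> *; ring.
  rewrite (dmean_cell (fun i j => b i j ^+ 3) G) mean_permstat_balanced //.
  rewrite (dmean_row (b := b) (phi := fun i s => b i (s i) ^+ 2 * G s)) //; last by move=> *; ring.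
  rewrite (dmean_col (b := b) (phi := fun k s => b k (s k) ^+ 2 * G s)) //; last by move=> *; ring.
  have z1 : dmean (fun i k s => b i (s k) ^+ 3 * b i (s i)) = 0.
    apply/eqP; have /eqP := dmean_same_row b (fun i j => b i j ^+ 3).
    rewrite big1 => [|i _]; last by rewrite (proj1 bb) mul0r.
    rewrite mulf_eq0 gt_eqF //= => /eqP e; rewrite -[X in _ == X]e; apply/eqP.
    by apply: eq_dmean => i k s; rewrite mulrC.
  have z2 : dmean (fun i k s => b i (s k) ^+ 3 * b k (s k)) = 0.
    apply/eqP; have /eqP := dmean_same_col b (fun i j => b i j ^+ 3).
    rewrite big1 => [|i _]; last by rewrite (proj2 bb) mul0r.
    rewrite mulf_eq0 gt_eqF //= => /eqP e; rewrite -[X in _ == X]e; apply/eqP.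
    by apply: eq_dmean => i k s; rewrite mulrC.
  rewrite z1 z2.
  rewrite (dmean_row (b := b) (phi := fun i s => b i (s i) ^+ 3)) //; last by move=> *; ring.
  rewrite (dmean_col (b := b) (phi := fun k s => b k (s k) ^+ 3)) //; last by move=> *; ring.
  by ring.
have main_le : n%:R * dmean main <= n%:R * X4 + 8 * X ^+ 2.
  rewrite /main !(dmeanD, dmeanZ) (dmean_cell (fun i j => b i j ^+ 4) (fun=> 1)) mean_cst.
  rewrite -/X4 (dmean_sym (fun i k s => b k (s i) * b i (s k) ^+ 3)).
  rewrite [X in _ + (_ + X)](eq_dmean (H := fun i k s => b i (s k) ^+ 3 * b k (s i)));
    last by move=> i k s; rewrite mulrC.
  rewrite (dmean_cross (fun i j => b i j ^+ 3) b).
  rewrite (eq_mean (H := fun s => permstat b s * permstat (fun i j => b i j ^+ 3) s));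
    last by move=> s; rewrite mulrC.
  have := permstat_cov (fun i j => b i j ^+ 3) bb.
  rewrite (_ : \sum_i \sum_j b i j * _ = X4); last first.
    by do 2![apply: eq_bigr => ? _]; rewrite -exprS.
  set K := mean _ => kE.
  have K0 : 0 <= K.
    have n1 : 0 < n%:R - 1 :> R by have := n_ge2; lra.
    by rewrite -(pmulr_rge0 _ n1) kE; exact: X4_ge0.
  have : n%:R * K <= 2 * X4.
    have := mulr_ge0 (_ : 0 <= n%:R - 2) K0.
    by move=> /(_ ltac:(rewrite subr_ge0; exact: n_ge2)); lra.
  by have := X4_le; set N := n%:R; rewrite !mulrDr; lra.
rewrite add0r -(ler_pM2l n_gt0) [leRHS]mulrDr.
rewrite [n%:R * (_ / _)]mulrC divfK ?gt_eqF //.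
by have := quad_bound; lra.
Qed.
End FourthMoment.

End Permstat.
End Mean.

(** * The Dirichlet form on the first level *)

Section CosetMeans.
Context {R : realFieldType} {n : nat}.
Implicit Types (f h : 'S_n -> R) (b : 'I_n -> 'I_n -> R).

(** The mean over a 1-coset, whose density is [1/n]. *)
Definition coset_mean f (i j : 'I_n) : R :=
  n%:R * mean (fun s => f s * (s i == j)%:R).

(** Every edge of the transposition graph is counted four times: it has two
    end points, and the transposition two ordered pairs of positions. *)
Definition dirichlet f : R :=
  dmean (fun i k s => (f (tperm i k * s)%g - f s) ^+ 2).

Lemma sum_ind_val (T : finType) (x : T) (F : T -> R) :
  \sum_y F y * (x == y)%:R = F x.
Proof.
rewrite (bigD1 x) //= eqxx mulr1 big1 ?addr0 // => y yx.
by rewrite eq_sym (negPf yx) mulr0.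
Qed.

Lemma sum_ind_pos (s : 'S_n) (j : 'I_n) : \sum_i (s i == j)%:R = 1 :> R.
Proof.
rewrite (sum_perm (fun i => (i == j)%:R)) (bigD1 j) //= eqxx big1 ?addr0 //.
by move=> i /negPf->.
Qed.

Lemma coset_mean_rows f i : \sum_j coset_mean f i j = n%:R * mean f.
Proof.
rewrite -mulr_sumr -mean_sum; congr (_ * _); apply: eq_mean => s.
exact: (sum_ind_val (s i) (fun=> f s)).
Qed.

Lemma coset_mean_cols f j : \sum_i coset_mean f i j = n%:R * mean f.
Proof.
rewrite -mulr_sumr -mean_sum; congr (_ * _); apply: eq_mean => s.
by rewrite -mulr_sumr sum_ind_pos mulr1.
Qed.

Lemma coset_mean_balanced f : mean f = 0 -> balanced (coset_mean f).
Proof.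
by move=> f0; split=> ?; rewrite ?coset_mean_rows ?coset_mean_cols f0 mulr0.
Qed.

Lemma mean_mul_permstat f b :
  n%:R * mean (fun s => f s * permstat b s) =
  \sum_i \sum_j b i j * coset_mean f i j.
Proof.
rewrite (eq_mean (H := fun s => \sum_i \sum_j b i j * (f s * (s i == j)%:R))).
  rewrite mean_sum mulr_sumr; apply: eq_bigr => i _.
  rewrite mean_sum mulr_sumr; apply: eq_bigr => j _.
  by rewrite meanZ mulrCA.
move=> s; rewrite /permstat mulr_sumr; apply: eq_bigr => i _.
rewrite -(sum_ind_val (s i) (b i)) mulr_sumr; apply: eq_bigr => j _.
by rewrite mulrCA.
Qed.

Lemma coset_mean_permstat b i j : balanced b ->
  (n%:R - 1) * coset_mean (permstat b) i j = n%:R * b i j.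
Proof.
move=> bb; rewrite mulrCA; congr (_ * _).
pose e (k m : 'I_n) : R := (k == i)%:R * (m == j)%:R.
rewrite (eq_mean (H := fun s => permstat b s * permstat e s)); last first.
  move=> s; congr (_ * _); rewrite /permstat (bigD1 i) //= /e eqxx mul1r.
  by rewrite big1 ?addr0 // => k /negPf->; rewrite mul0r.
rewrite permstat_cov // (bigD1 i) //= (bigD1 j) //= /e !eqxx !mulr1.
rewrite big1 ?addr0 => [|m /negPf->]; last by rewrite !mulr0.
rewrite big1 ?addr0 // => k /negPf ki.
by rewrite big1 // => m _; rewrite ki mul0r mulr0.
Qed.

(** Balanced statistics are eigenfunctions: a swap changes the statistic by
    [b i (s k) + b k (s i) - b i (s i) - b k (s k)], and summing over all pairs
    leaves [- 2 n] times the statistic.  In this polarised form it also gives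
    the orthogonality used in the decomposition that follows. *)
Lemma dirichlet_permstat_polar b h : balanced b ->
  dmean (fun i k s => (permstat b (tperm i k * s)%g - permstat b s)
                      * (h (tperm i k * s)%g - h s)) =
  4 * n%:R * mean (fun s => permstat b s * h s).
Proof.
move=> bb.
pose d i k (s : 'S_n) := b i (s k) + b k (s i) - b i (s i) - b k (s k).
have dh : dmean (fun i k s => d i k s * h s) =
          - (2 * n%:R * mean (fun s => permstat b s * h s)).
  have xh : dmean (fun i k s => b i (s i) * h s) =
            n%:R * mean (fun s => permstat b s * h s).
    rewrite -meanZ; apply: eq_mean => s.
    rewrite /permstat mulrA mulrC !mulr_sumr; apply: eq_bigr => i _.
    by rewrite sumr_const card_ord -mulr_natl; ring.
  rewrite (eq_dmean (H := fun i k s => h s * b i (s k) + (h s * b k (s i)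
     + (- (b i (s i) * h s) + - (b k (s k) * h s))))); last first.
    by move=> i k s; rewrite /d; ring.
  rewrite !dmeanD !dmeanN (dmean_row (b := b) (phi := fun _ s => h s)) //.
  rewrite (dmean_sym (fun i k s => h s * b i (s k))).
  rewrite (dmean_row (b := b) (phi := fun _ s => h s)) //.
  rewrite (dmean_sym (fun i k s => b i (s i) * h s)) xh; ring.
rewrite (eq_dmean (H := fun i k s =>
    - (d i k (tperm i k * s)%g * h (tperm i k * s)%g) + - (d i k s * h s))).
  rewrite dmeanD !dmeanN (dmean_tperm (fun i k s => d i k s * h s)) dh; ring.
by move=> i k s; rewrite permstat_tperm /d tperm_mulL tperm_mulR; ring.
Qed.

Lemma dirichlet_permstat_add b h : balanced b ->
  (forall i j, coset_mean h i j = 0) ->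
  dirichlet (fun s => permstat b s + h s) =
  4 * n%:R * mean (fun s => permstat b s ^+ 2) + dirichlet h.
Proof.
move=> bb h0.
have G2 : mean (fun s => permstat b s * permstat b s) =
          mean (fun s => permstat b s ^+ 2) by [].
have Gh : 4 * n%:R * mean (fun s => permstat b s * h s) = 0.
  rewrite -mulrA (eq_mean (H := fun s => h s * permstat b s)); last first.
    by move=> s; rewrite mulrC.
  rewrite mean_mul_permstat big1 ?mulr0 // => i _; rewrite big1 // => j _.
  by rewrite h0 mulr0.
rewrite -G2 -dirichlet_permstat_polar // /dirichlet -[LHS]addr0 -(mulr0 2) -Gh.
rewrite -[in LHS]dirichlet_permstat_polar // -dmeanZ -[RHS]addr0 -(mulr0 4) -Gh.
rewrite -[in RHS]dirichlet_permstat_polar // -dmeanZ -!dmeanD.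
by apply: eq_dmean => i k s; ring.
Qed.

End CosetMeans.

(** * Pair statistics *)

Section PairStatistics.
Context {R : realFieldType} {n : nat}.

(** Averaging [s a] over the positions in [P] that the rest of the integrand
    does not distinguish; this replaces the computation of conditional
    expectations given the values of [s] outside [P]. *)
Lemma mean_exchange_off (P : pred 'I_n) (Phi : 'I_n -> 'I_n -> 'S_n -> R) :
  (forall a d b c s, P a -> P d -> Phi b c (tperm a d * s)%g = Phi b c s) ->
  (\sum_(a | P a) 1) * mean (fun s => \sum_(a | P a) Phi a (s a) s) =
  mean (fun s => \sum_(a | P a) \sum_(d | P d) Phi a (s d) s).
Proof.
move=> PhiP; rewrite !mean_sum mulr_sumr; apply: eq_bigr => a Pa.
rewrite mean_sum mulr_suml; apply: eq_bigr => d Pd; rewrite mul1r.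
rewrite -(mean_tperm a d); apply: eq_mean => s.
by rewrite PhiP // tperm_mulL.
Qed.

Lemma mean_value (i : 'I_n) (psi : 'I_n -> R) :
  n%:R * mean (fun s => psi (s i)) = \sum_j psi j.
Proof.
pose b (k j : 'I_n) := (k == i)%:R * psi j.
rewrite (eq_mean (H := permstat b)) => [|s].
  rewrite mean_permstat (bigD1 i) //= [X in _ + X]big1 ?addr0 => [|k /negPf ki].
    by apply: eq_bigr => j _; rewrite /b eqxx mul1r.
  by rewrite big1 // => j _; rewrite /b ki mul0r.
rewrite /permstat (bigD1 i) //= big1 ?addr0 => [|k /negPf ki].
  by rewrite /b eqxx mul1r.
by rewrite /b ki mul0r.
Qed.

Lemma mean_pair_value (i k : 'I_n) (phi : 'I_n -> 'I_n -> R) :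
  i != k -> (forall j, phi j j = 0) ->
  n%:R * (n%:R - 1) * mean (fun s => phi (s i) (s k)) = \sum_j \sum_m phi j m.
Proof.
move=> ik phi0; rewrite -mulrA -(mean_value i (fun j => \sum_m phi j m)).
congr (_ * _); have -> : n%:R - 1 = \sum_(c : 'I_n | c != i) 1 :> R.
  have := sum_perm (n := n) (R := R) (fun=> 1) 1%g.
  rewrite [LHS](bigD1 i) //= [RHS]sumr_const card_ord => <-; ring.
rewrite mulr_suml [RHS](eq_mean (H := fun s =>
  \sum_(c | c != i) phi (s i) (s c))) => [|s]; last first.
  by rewrite -(sum_perm (fun m => phi (s i) m) s) (bigD1 i) //= phi0 add0r.
rewrite mean_sum; apply: eq_bigr => c ci; rewrite mul1r.
rewrite -(mean_tperm k c); apply: eq_mean => s.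
by rewrite tperm_mulL tperm_mulD // eq_sym.
Qed.

Variable w : 'I_n -> 'I_n -> 'I_n -> 'I_n -> R.
Hypotheses (w_sym : forall i j k m, w i j k m = w k m i j)
           (w_row : forall i j k, \sum_m w i j k m = 0)
           (w_col : forall i j m, \sum_k w i j k m = 0)
           (w_pos : forall i j m, w i j i m = 0)
           (w_val : forall i j k, w i j k j = 0).

Definition pairstat (s : 'S_n) : R := \sum_i \sum_k w i (s i) k (s k).

Section FixedPair.
Variables (i k : 'I_n).
Hypothesis ik : i != k.
Let ki : k != i. Proof. by rewrite eq_sym. Qed.
Let off (a : 'I_n) := (a != i) && (a != k).
Let wik (s : 'S_n) := w i (s i) k (s k).
Let wki (s : 'S_n) := w i (s k) k (s i).

Let sum_off_off (T : 'I_n -> 'I_n -> R) :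
  (forall a, \sum_d T a d = 0) -> (forall d, \sum_a T a d = 0) ->
  \sum_(a | off a) \sum_(d | off d) T a d = T i i + T i k + T k i + T k k.
Proof.
move=> Tr Tc; rewrite (eq_bigr (fun a => - (T a i + T a k))) => [|a _].
  by rewrite sumrN sum_off2 // big_split /= !Tc; ring.
by rewrite sum_off2 // Tr; ring.
Qed.

Let off_tperm a d s : off a -> off d ->
  (tperm a d * s)%g i = s i /\ (tperm a d * s)%g k = s k.
Proof. by move=> /andP[ai ak] /andP[di dk]; rewrite !tperm_mulD. Qed.

Let off_card : \sum_(a | off a) 1 = n%:R - 2 :> R.
Proof. by rewrite sum_off2 // sumr_const card_ord; ring. Qed.

(* Pairs meeting the pair [{i, k}] in one position: the zero sums of [w]
   collapse the average onto the positions [i] and [k] themselves. *)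
Let star (x : 'I_n) (y : 'I_n -> 'I_n -> 'I_n) :
  (n%:R - 2) * mean (fun s => wik s *
     \sum_(b | off b) w x (y (s i) (s k)) b (s b)) =
  mean (fun s => wik s *
     (w x (y (s i) (s k)) i (s i) + w x (y (s i) (s k)) i (s k) +
      w x (y (s i) (s k)) k (s i) + w x (y (s i) (s k)) k (s k))).
Proof.
pose Phi b c (s : 'S_n) := wik s * w x (y (s i) (s k)) b c.
rewrite -off_card.
rewrite (eq_mean (H := fun s => \sum_(b | off b) Phi b (s b) s)); last first.
  by move=> s; rewrite mulr_sumr.
rewrite mean_exchange_off => [|a d b c s oa od]; last first.
  by rewrite /Phi /wik; have [-> ->] := off_tperm s oa od.
apply: eq_mean => s; rewrite -(sum_off_off (T := fun b d => w x (y (s i) (s k)) b (s d))).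
- by rewrite mulr_sumr; apply: eq_bigr => b _; rewrite mulr_sumr.
- by move=> b; rewrite (sum_perm (fun m => w x (y (s i) (s k)) b m)) w_row.
- by move=> d; rewrite w_col.
Qed.

(* Pairs disjoint from [{i, k}] reduce, after averaging one of their
   positions, to pairs meeting it in one position. *)
Let disjoint_pairs b : off b ->
  (n%:R - 3) * mean (fun s => wik s * \sum_(a | off a) w a (s a) b (s b)) =
  mean (fun s => wik s * (w i (s i) b (s b) + w i (s k) b (s b) +
                          w k (s i) b (s b) + w k (s k) b (s b))).
Proof.
move=> ob; pose offb a := off a && (a != b).
have drop_b (F : 'I_n -> R) : F b = 0 ->
    \sum_(a | off a) F a = \sum_(a | offb a) F a.
  by move=> Fb; rewrite (bigD1 b) //= Fb add0r.
have -> : n%:R - 3 = \sum_(a | offb a) 1 :> R.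
  by have := off_card; rewrite (bigD1 b) //= => e; lra.
pose Phi a c (s : 'S_n) := wik s * w a c b (s b).
rewrite (eq_mean (H := fun s => \sum_(a | offb a) Phi a (s a) s)); last first.
  by move=> s; rewrite drop_b ?w_pos // mulr_sumr.
rewrite mean_exchange_off => [|a d c e s /andP[oa ab] /andP[od db]]; last first.
  rewrite /Phi /wik; have [-> ->] := off_tperm s oa od.
  by rewrite tperm_mulD.
apply: eq_mean => s.
rewrite -(sum_off_off (T := fun a d => w a (s d) b (s b))).
- rewrite mulr_sumr drop_b; last first.
    by rewrite big1 ?mulr0 // => d _; rewrite w_pos.
  apply: eq_bigr => a _; rewrite mulr_sumr drop_b //.
  by rewrite w_sym w_val mulr0.
- move=> a; rewrite (sum_perm (fun m => w a m b (s b))).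
  by under eq_bigr do rewrite w_sym; rewrite w_row.
- by move=> d; under eq_bigr do rewrite w_sym; rewrite w_col.
Qed.

Let pairstat_split s :
  pairstat s = 2 * wik s + 2 * (\sum_(b | off b) w i (s i) b (s b))
    + 2 * (\sum_(b | off b) w k (s k) b (s b))
    + \sum_(b | off b) \sum_(a | off a) w a (s a) b (s b).
Proof.
pose g a := \sum_b w a (s a) b (s b).
have gE a : \sum_b w b (s b) a (s a) = g a.
  by apply: eq_bigr => b _; rewrite w_sym.
have wE : w k (s k) i (s i) = wik s by rewrite w_sym.
rewrite [X in _ + X](eq_bigr (fun b => g b - w i (s i) b (s b) - w k (s k) b (s b))).
  rewrite !big_split /= !sumrN !sum_off2 // !w_pos -/(g i) -/(g k) wE -/(wik s).
  rewrite /pairstat -/(\sum_a g a); ring.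
by move=> b _; rewrite sum_off2 // gE.
Qed.

Let mean_wiki : mean (fun s => wik s * wki s) <= mean (fun s => wik s ^+ 2).
Proof.
have e : mean (fun s => wki s ^+ 2) = mean (fun s => wik s ^+ 2).
  rewrite -(mean_tperm i k); apply: eq_mean => s.
  by rewrite /wki /wik tperm_mulL tperm_mulR.
have : 0 <= mean (fun s => (wik s - wki s) ^+ 2).
  by apply: mean_ge0 => s; apply: sqr_ge0.
rewrite (eq_mean (H := fun s => wik s ^+ 2 + (-2 * (wik s * wki s) + wki s ^+ 2))).
  by rewrite !(meanD, meanZ) e; lra.
by move=> s; ring.
Qed.

Lemma mean_pair_pairstat : (3 < n)%N ->
  (n%:R - 3) * mean (fun s => w i (s i) k (s k) * pairstat s) <=
  2 * (n%:R - 1) * mean (fun s => w i (s i) k (s k) ^+ 2).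
Proof.
rewrite -/(wik _) => n3; have N3 : 4 <= n%:R :> R by rewrite ler_nat.
pose A x (y : 'S_n -> 'I_n) :=
  mean (fun s => wik s * \sum_(b | off b) w x (y s) b (s b)).
pose Y := mean (fun s => wik s * \sum_(b | off b) \sum_(a | off a) w a (s a) b (s b)).
pose E2 := mean (fun s => wik s ^+ 2).
pose Et := mean (fun s => wik s * wki s).
have Aii : (n%:R - 2) * A i (fun s => s i) = E2.
  rewrite [LHS](star i (fun j _ => j)); apply: eq_mean => s.
  by rewrite !w_pos w_val -/(wik s); ring.
have Akk : (n%:R - 2) * A k (fun s => s k) = E2.
  rewrite [LHS](star k (fun _ m => m)); apply: eq_mean => s.
  by rewrite !w_pos w_val w_sym -/(wik s); ring.
have Aik : (n%:R - 2) * A i (fun s => s k) = Et.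
  rewrite [LHS](star i (fun _ m => m)); apply: eq_mean => s.
  by rewrite !w_pos w_val -/(wki s); ring.
have Aki : (n%:R - 2) * A k (fun s => s i) = Et.
  rewrite [LHS](star k (fun j _ => j)); apply: eq_mean => s.
  by rewrite !w_pos w_val w_sym -/(wki s); ring.
have YE : (n%:R - 3) * Y = A i (fun s => s i) + A i (fun s => s k)
                          + A k (fun s => s i) + A k (fun s => s k).
  rewrite /Y (eq_mean (H := fun s =>
    \sum_(b | off b) (wik s * \sum_(a | off a) w a (s a) b (s b)))); last first.
    by move=> s; rewrite mulr_sumr.
  rewrite mean_sum mulr_sumr (eq_bigr _ disjoint_pairs) -mean_sum -!meanD.
  apply: eq_mean => s; rewrite -!mulrDr -!big_split mulr_sumr.
  by apply: eq_bigr.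
have -> : mean (fun s => wik s * pairstat s) =
          2 * E2 + 2 * A i (fun s => s i) + 2 * A k (fun s => s k) + Y.
  rewrite -!meanZ -!meanD; apply: eq_mean => s; rewrite pairstat_split; ring.
have EtE : Et <= E2 := mean_wiki.
have N2 : 0 < n%:R - 2 :> R by lra.
rewrite -/E2 -(ler_pM2l N2).
rewrite [leLHS](_ : _ = 2 * (n%:R - 2) * (n%:R - 3) * E2
    + 2 * (n%:R - 3) * ((n%:R - 2) * A i (fun s => s i))
    + 2 * (n%:R - 3) * ((n%:R - 2) * A k (fun s => s k))
    + (n%:R - 2) * ((n%:R - 3) * Y)); last by ring.
rewrite YE !mulrDr Aii Akk Aik Aki.
lra.
Qed.

End FixedPair.

(** The factor 2 arises because a pair statistic counts every unordered pair
    of positions twice; pairs of positions that are not equal contribute only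
    lower-order terms.  It is this factor that puts the second level of the
    spectrum about twice as high as the first. *)
Lemma pairstat_second_moment : (3 < n)%N ->
  n%:R * (n%:R - 3) * mean (fun s => pairstat s ^+ 2) <=
  2 * \sum_i \sum_j \sum_k \sum_m w i j k m ^+ 2.
Proof.
move=> n3; have N3 : 4 <= n%:R :> R by rewrite ler_nat.
rewrite (eq_mean (H := fun s => \sum_i \sum_k w i (s i) k (s k) * pairstat s)).
  rewrite mean_sum mulr_sumr mulr_sumr; apply: ler_sum => i _.
  rewrite mean_sum mulr_sumr exchange_big mulr_sumr; apply: ler_sum => k _.
  have [<-|ik] := eqVneq i k.
    rewrite (eq_mean (H := fun=> 0)) => [|s]; last by rewrite w_pos mul0r.
    rewrite mean_cst mulr0 mulr_ge0 ?ler0n //.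
    by do 2![apply: sumr_ge0 => ? _]; apply: sqr_ge0.
  rewrite -(mean_pair_value (phi := fun j m => w i j k m ^+ 2) ik); last first.
    by move=> j; rewrite w_val expr0n.
  have := mean_pair_pairstat ik n3.
  have N0 : 0 < n%:R :> R by lra.
  by move=> le12; move: (ler_wpM2l (ltW N0) le12); lra.
move=> s; rewrite expr2 /pairstat mulr_suml; apply: eq_bigr => i _.
by rewrite mulr_suml.
Qed.

End PairStatistics.

Section PairEnergy.
Context {R : realFieldType} {n : nat}.
Implicit Types f : 'S_n -> R.

Definition pair_mean f (i j k m : 'I_n) : R :=
  mean (fun s => f s * (s i == j)%:R * (s k == m)%:R).

Definition pair_energy f : R :=
  \sum_i \sum_j \sum_k \sum_m pair_mean f i j k m ^+ 2.

Lemma pair_meanC f i j k m : pair_mean f i j k m = pair_mean f k m i j.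
Proof. by apply: eq_mean => s; rewrite mulrAC. Qed.

Variable f : 'S_n -> R.
Hypothesis f0 : forall i j, coset_mean f i j = 0.

Let mean0 i j : mean (fun s => f s * (s i == j)%:R) = 0.
Proof.
apply/eqP; have /eqP := f0 i j; rewrite mulf_eq0 pnatr_eq0 => /orP[/eqP n0|//].
by have := ltn_ord i; rewrite {2}n0.
Qed.

Let w := pair_mean f.

Let w_row i j k : \sum_m w i j k m = 0.
Proof.
rewrite /w /pair_mean -mean_sum -[RHS](mean0 i j); apply: eq_mean => s.
exact: (sum_ind_val (s k) (fun=> f s * (s i == j)%:R)).
Qed.

Let w_col i j m : \sum_k w i j k m = 0.
Proof.
rewrite /w /pair_mean -mean_sum -[RHS](mean0 i j); apply: eq_mean => s.
by rewrite -mulr_sumr sum_ind_pos mulr1.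
Qed.

Lemma pair_mean_pos i j m : pair_mean f i j i m = 0.
Proof.
have [->|jm] := eqVneq j m.
  rewrite -[RHS](mean0 i m); apply: eq_mean => s.
  by rewrite -mulrA -natrM mulnb andbb.
rewrite -[RHS](mean_cst (n := n)); apply: eq_mean => s.
rewrite -mulrA -natrM mulnb; case: eqP => [->|_]; last by rewrite mulr0.
by rewrite (negPf jm) mulr0.
Qed.

Lemma pair_mean_val i j k : pair_mean f i j k j = 0.
Proof.
have [->|ik] := eqVneq i k; first exact: pair_mean_pos.
rewrite -[RHS](mean_cst (n := n)); apply: eq_mean => s.
rewrite -mulrA -natrM mulnb; case: eqP => [<-|_]; last by rewrite mulr0.
by rewrite (inj_eq perm_inj) eq_sym (negPf ik) mulr0.
Qed.

Let mean_f_pairstat : mean (fun s => f s * pairstat w s) = pair_energy f.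
Proof.
rewrite (eq_mean (H := fun s => \sum_i \sum_j \sum_k \sum_m
   w i j k m * (f s * (s i == j)%:R * (s k == m)%:R))).
  do 4![rewrite mean_sum; apply: eq_bigr => ? _].
  by rewrite meanZ expr2.
move=> s; rewrite /pairstat mulr_sumr; apply: eq_bigr => i _.
rewrite -(sum_ind_val (s i) (fun j => \sum_k w i j k (s k))) mulr_sumr.
apply: eq_bigr => j _; rewrite mulr_suml mulr_sumr; apply: eq_bigr => k _.
rewrite -(sum_ind_val (s k) (w i j k)) mulr_suml mulr_sumr.
by apply: eq_bigr => m _; ring.
Qed.

(** Bessel's inequality for [f] and the pair statistic of its own
    correlations. *)
Lemma pair_energy_le :
  n%:R * (n%:R - 3) * pair_energy f <= 2 * mean (fun s => f s ^+ 2).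
Proof.
have W0 : 0 <= pair_energy f.
  by do 4![apply: sumr_ge0 => ? _]; apply: sqr_ge0.
have f20 : 0 <= mean (fun s => f s ^+ 2).
  by apply: mean_ge0 => s; apply: sqr_ge0.
have [n3|n3] := leqP n 3.
  have N3 : 3 - n%:R >= 0 :> R by rewrite subr_ge0 ler_nat.
  have := mulr_ge0 (mulr_ge0 (ler0n R n) N3) W0; lra.
have G2 := pairstat_second_moment (pair_meanC f) w_row w_col pair_mean_pos pair_mean_val n3.
rewrite -/(pair_energy f) in G2.
have N3 : n%:R >= 4 :> R by rewrite ler_nat.
(* the optimal multiple of the pair statistic to subtract from [f] *)
pose c : R := n%:R * (n%:R - 3) / 2.
have c0 : 0 <= c by rewrite /c divr_ge0 // mulr_ge0 //; lra.
have : 0 <= mean (fun s => (f s - c * pairstat w s) ^+ 2).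
  by apply: mean_ge0 => s; apply: sqr_ge0.
rewrite (eq_mean (H := fun s => f s ^+ 2 + (- (2 * c) * (f s * pairstat w s)
    + c ^+ 2 * pairstat w s ^+ 2))); last by move=> s; ring.
rewrite !(meanD, meanZ) mean_f_pairstat.
have : c ^+ 2 * mean (fun s => pairstat w s ^+ 2) <= c * pair_energy f.
  rewrite expr2 -mulrA ler_wpM2l // /c; lra.
rewrite /c; lra.
Qed.

End PairEnergy.

(** * Restriction to a coset and the spectral gap *)

Section Lift.
Context {R : realFieldType}.

Lemma sum_lift_perm n (k j : 'I_n.+1) (F : 'S_n.+1 -> R) :
  \sum_(s : 'S_n.+1 | s k == j) F s = \sum_t F (lift_perm k j t).
Proof.
pose drop (s : 'S_n.+1) a := odflt a (unlift (s k) (s (lift k a))).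
have dropK (s : 'S_n.+1) a : lift (s k) (drop s a) = s (lift k a).
  rewrite /drop; have := neq_lift k a.
  by rewrite -(can_eq (permK s)) => /unlift_some[] ? ? ->.
have drop_inj s : injective (drop s).
  move=> a b ab; apply: (@lift_inj _ k); apply: (@perm_inj _ s).
  by rewrite -!dropK ab.
rewrite (reindex (lift_perm k j)); last first.
  exists (fun s => perm (drop_inj s)) => [t _|s /eqP sk].
    apply/permP=> a; rewrite permE; apply: (@lift_inj _ j).
    by have := dropK (lift_perm k j t) a; rewrite lift_perm_id lift_perm_lift.
  apply/permP=> a; case: (unliftP k a) => [b|] ->; rewrite ?lift_perm_id //.
  by rewrite lift_perm_lift -sk permE dropK.
by apply: eq_bigl => t; rewrite lift_perm_id eqxx.
Qed.

Lemma coset_mean_lift n (f : 'S_n.+1 -> R) k j :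
  coset_mean f k j = mean (fun t => f (lift_perm k j t)).
Proof.
rewrite /coset_mean /mean -sum_lift_perm factS natrM invfM mulrA mulrA.
rewrite divff ?pnatr_eq0 // mul1r; congr (_ * _); rewrite [RHS]big_mkcond.
by apply: eq_bigr => s _; case: ifP; rewrite ?mulr1 ?mulr0.
Qed.

Lemma lift_perm_tperm n (k j : 'I_n.+1) (a b : 'I_n) (t : 'S_n) :
  lift_perm k j (tperm a b * t)%g =
  (tperm (lift k a) (lift k b) * lift_perm k j t)%g.
Proof.
apply/permP=> x; case: (unliftP k x) => [y|] ->.
  by rewrite permM -(inj_tperm _ _ _ (@lift_inj _ k)) !lift_perm_lift permM.
by rewrite permM tpermD ?lift_perm_id // eq_sym neq_lift.
Qed.

Lemma sum_lift n (k : 'I_n.+1) (F : 'I_n.+1 -> R) :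
  \sum_a F (lift k a) = \sum_a F a - F k.
Proof. by rewrite (bigD1_ord k) //=; ring. Qed.

(** A transposition of two positions is seen by the [n - 1] conditionings on
    the value at one of the other positions, when the degree is [n + 1]; the
    other factor undoes the averaging over that value. *)
Lemma dirichlet_lift n (f : 'S_n.+1 -> R) :
  \sum_k \sum_j dirichlet (fun t => f (lift_perm k j t)) =
  n.+1%:R * (n.+1%:R - 2) * dirichlet f.
Proof.
pose T a b s := (f (tperm a b * s)%g - f s) ^+ 2.
have T0 a s : T a a s = 0 by rewrite /T tperm1 mul1g subrr expr0n.
pose F k s := \sum_a \sum_b T (lift k a) (lift k b) s.
have dE k : \sum_j dirichlet (fun t => f (lift_perm k j t)) = n.+1%:R * mean (F k).
  rewrite -(coset_mean_rows _ k); apply: eq_bigr => j _; rewrite coset_mean_lift.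
  apply: eq_mean => t; do 2![apply: eq_bigr => ? _].
  by rewrite lift_perm_tperm.
rewrite (eq_bigr _ (fun k _ => dE k)) -mulr_sumr -mulrA; congr (_ * _).
rewrite -mean_sum -meanZ; apply: eq_mean => s.
rewrite (eq_bigr (fun k => \sum_a \sum_b T a b s - \sum_b T k b s - \sum_a T a k s)).
  rewrite !big_split /= !sumrN sumr_const card_ord -mulr_natl.
  by rewrite [X in _ - X]exchange_big /T; ring.
move=> k _; rewrite /F (sum_lift k (fun a => \sum_b T a (lift k b) s)).
rewrite (eq_bigr (fun a => \sum_b T a b s - T a k s)); last first.
  by move=> a _; rewrite (sum_lift k (fun b => T a b s)).
by rewrite (sum_lift k (fun b => T k b s)) T0 big_split /= sumrN; ring.
Qed.

End Lift.

Section LevelOne.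
Context {R : realFieldType} {n : nat}.
Hypothesis n_gt1 : (1 < n)%N.
Variable f : 'S_n -> R.
Hypothesis f0 : mean f = 0.

Let n_ge2 : 2 <= n%:R :> R. Proof. by rewrite ler_nat. Qed.
Let b i j : R := (n%:R - 1) / n%:R * coset_mean f i j.
Let h s := f s - permstat b s.

Let bb : balanced b.
Proof.
have [r c] := coset_mean_balanced f0.
by split=> ?; rewrite -mulr_sumr ?r ?c mulr0.
Qed.

Lemma coset_mean_residual i j : coset_mean h i j = 0.
Proof.
have n1 : n%:R - 1 != 0 :> R by rewrite gt_eqF //; have := n_ge2; lra.
have n0 : n%:R != 0 :> R by rewrite gt_eqF //; have := n_ge2; lra.
have -> : coset_mean h i j = coset_mean f i j - coset_mean (permstat b) i j.
  rewrite /coset_mean -mulrBr -meanB; congr (_ * _); apply: eq_mean => s.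
  by rewrite /h mulrBl.
apply/eqP; rewrite subr_eq0; apply/eqP; apply: (mulfI n1).
by rewrite coset_mean_permstat // /b; field.
Qed.

Let mean_b2 : mean (fun s => permstat b s ^+ 2) =
  (n%:R - 1) / n%:R ^+ 2 * \sum_i \sum_j coset_mean f i j ^+ 2.
Proof.
have n1 : n%:R - 1 != 0 :> R by rewrite gt_eqF //; have := n_ge2; lra.
have n0 : n%:R != 0 :> R by rewrite gt_eqF //; have := n_ge2; lra.
apply: (mulfI n1); rewrite [LHS](permstat_cov b bb) !mulr_sumr.
apply: eq_bigr => i _; rewrite !mulr_sumr; apply: eq_bigr => j _.
by rewrite /b; field.
Qed.

Let mean_h2 : mean (fun s => f s ^+ 2) =
  mean (fun s => permstat b s ^+ 2) + mean (fun s => h s ^+ 2).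
Proof.
have n0 : n%:R != 0 :> R by rewrite gt_eqF //; have := n_ge2; lra.
have hb : mean (fun s => h s * permstat b s) = 0.
  apply: (mulfI n0); rewrite mean_mul_permstat mulr0 big1 // => i _.
  by rewrite big1 // => j _; rewrite coset_mean_residual mulr0.
rewrite -[RHS]addr0 -[X in _ + X](mulr0 2) -hb -meanZ -!meanD.
by apply: eq_mean => s; rewrite /h; ring.
Qed.

Lemma coset_mean_bessel :
  (n%:R - 1) / n%:R ^+ 2 * \sum_i \sum_j coset_mean f i j ^+ 2 <=
  mean (fun s => f s ^+ 2).
Proof.
by rewrite mean_h2 -mean_b2 lerDl; apply: mean_ge0 => s; apply: sqr_ge0.
Qed.

(** A bound on functions with vanishing coset means extends to all functions
    of mean zero: the projection to the statistics is an eigenvector and is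
    orthogonal to the rest. *)
Lemma level_one_reduction :
  (forall g : 'S_n -> R, (forall i j, coset_mean g i j = 0) ->
     8 * (n%:R - 1) * mean (fun s => g s ^+ 2) <= dirichlet g) ->
  8 * (n%:R - 1) * mean (fun s => f s ^+ 2)
    - 4 * (n%:R - 2) * ((n%:R - 1) / n%:R ^+ 2
                        * \sum_i \sum_j coset_mean f i j ^+ 2) <= dirichlet f.
Proof.
move=> /(_ h coset_mean_residual) hD.
have -> : dirichlet f = 4 * n%:R * mean (fun s => permstat b s ^+ 2) + dirichlet h.
  rewrite -dirichlet_permstat_add //; last exact: coset_mean_residual.
  by apply: eq_dmean => i k s; rewrite /h; ring.
rewrite mean_h2 -mean_b2; lra.
Qed.

End LevelOne.

Section SpectralGap.
Context {R : realFieldType}.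

Lemma mean_S1 (F : 'S_1 -> R) : mean F = F 1%g.
Proof.
rewrite -[RHS](mean_cst (n := 1)); apply: eq_mean => s; congr F.
by apply/permP => a; rewrite perm1 !ord1.
Qed.

(** In degree 2 the 1-cosets are single permutations. *)
Lemma coset_means0_S2 (f : 'S_2 -> R) :
  (forall i j, coset_mean f i j = 0) -> mean (fun s => f s ^+ 2) = 0.
Proof.
move=> f0; have n0 : 2%:R != 0 :> R by rewrite pnatr_eq0.
apply: (mulfI n0); rewrite mulr0 -(coset_mean_rows _ ord0) big1 // => j _.
have := f0 ord0 j; rewrite !coset_mean_lift !mean_S1 => ->.
by rewrite expr0n.
Qed.

Lemma coset_mean_lift_pair n (f : 'S_n.+1 -> R) k j l r :
  coset_mean (fun t => f (lift_perm k j t)) l r =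
  n%:R * n.+1%:R * pair_mean f k j (lift k l) (lift j r).
Proof.
rewrite /coset_mean -mulrA; congr (_ * _).
rewrite pair_meanC -[RHS]/(coset_mean
  (fun s => f s * (s (lift k l) == lift j r)%:R) k j) coset_mean_lift.
by apply: eq_mean => t; rewrite lift_perm_lift (inj_eq lift_inj).
Qed.

(** Irreducible components beyond the first level have Laplacian eigenvalue at
    least twice the degree minus two.  The restrictions of [f] to the cosets
    have mean zero but not vanishing coset means, so the induction hypothesis
    is used in the form of [level_one_reduction]; the first-level parts of all
    restrictions add up to the pair energy of [f]. *)
Lemma second_level_gap n (f : 'S_n.+2 -> R) :
  (forall i j, coset_mean f i j = 0) ->
  8 * (n.+2%:R - 1) * mean (fun s => f s ^+ 2) <= dirichlet f.
Proof.
elim: n f => [|n IHn] f f0.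
  rewrite coset_means0_S2 // mulr0; apply: mean_ge0 => s.
  by do 2![apply: sumr_ge0 => ? _]; apply: sqr_ge0.
pose M : R := n.+2%:R; have NE : n.+3%:R = M + 1 by rewrite -natr1.
have M2 : 2 <= M by rewrite ler_nat.
pose g k j t := f (lift_perm k j t).
have g0 k j : mean (g k j) = 0 by rewrite -coset_mean_lift f0.
have gap k j := level_one_reduction (isT : (1 < n.+2)%N) (g0 k j) IHn.
have sum_g2 : \sum_k \sum_j mean (fun t => g k j t ^+ 2) =
              (M + 1) ^+ 2 * mean (fun s => f s ^+ 2).
  rewrite (eq_bigr (fun k => n.+3%:R * mean (fun s => f s ^+ 2))).
    by rewrite sumr_const card_ord -mulr_natl NE; ring.
  move=> k _; rewrite -(coset_mean_rows _ k); apply: eq_bigr => j _.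
  by rewrite coset_mean_lift.
have sum_a2 : \sum_k \sum_j \sum_l \sum_r coset_mean (g k j) l r ^+ 2 =
              (M * (M + 1)) ^+ 2 * pair_energy f.
  rewrite mulr_sumr; apply: eq_bigr => k _; rewrite mulr_sumr.
  apply: eq_bigr => j _.
  rewrite [in RHS](bigD1_ord k) //= [X in _ * (X + _)]big1 ?add0r => [|r _]; last first.
    by rewrite pair_mean_pos // expr0n.
  rewrite mulr_sumr; apply: eq_bigr => l _.
  rewrite [in RHS](bigD1_ord j) //= pair_mean_val // expr0n add0r.
  rewrite mulr_sumr; apply: eq_bigr => r _.
  by rewrite coset_mean_lift_pair NE; ring.
have total : \sum_k \sum_j (8 * (M - 1) * mean (fun t => g k j t ^+ 2)
    - 4 * (M - 2) * ((M - 1) / M ^+ 2 * \sum_l \sum_r coset_mean (g k j) l r ^+ 2))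
    <= (M + 1) * (M - 1) * dirichlet f.
  have -> : (M + 1) * (M - 1) = n.+3%:R * (n.+3%:R - 2) by rewrite NE; ring.
  rewrite -dirichlet_lift; apply: ler_sum => k _; apply: ler_sum => j _.
  exact: gap.
move: total; rewrite (eq_bigr (fun k =>
    8 * (M - 1) * (\sum_j mean (fun t => g k j t ^+ 2))
    - 4 * (M - 2) * ((M - 1) / M ^+ 2
      * \sum_j \sum_l \sum_r coset_mean (g k j) l r ^+ 2))); last first.
  by move=> k _; rewrite sumrB !mulr_sumr.
rewrite sumrB -!mulr_sumr sum_g2 sum_a2.
have := pair_energy_le f0; rewrite NE.
set W := pair_energy f; set E := mean _; set D := dirichlet f => WE.
have -> : (M - 1) / M ^+ 2 * ((M * (M + 1)) ^+ 2 * W) =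
          (M - 1) * (M + 1) * ((M + 1) * W).
  by field; rewrite gt_eqF //; lra.
move=> total; have M1 : 0 < (M + 1) * (M - 1) by rewrite mulr_gt0 //; lra.
rewrite -(ler_pM2l M1) (le_trans _ total) //.
have := ler_wpM2l (ltW M1) WE.
lra.
Qed.

End SpectralGap.

(** * Counting in cosets *)

Section CosetCounting.
Context {R : realFieldType} {n : nat}.
Implicit Types A : {set 'S_n}.

Definition ind A (s : 'S_n) : R := (s \in A)%:R.

Lemma mean_ind A : (n`!)%:R * mean (ind A) = #|A|%:R.
Proof.
rewrite /mean mulVKf ?gt_eqF ?natr_fact_gt0 // -sum1_card natr_sum.
rewrite [in RHS]big_mkcond.
by apply: eq_bigr => s _; rewrite /ind; case: (s \in A).
Qed.

Lemma mean_value_eq (i j : 'I_n) : n%:R * mean (fun s => (s i == j)%:R) = 1 :> R.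
Proof.
rewrite (mean_value i (fun x => (x == j)%:R)) (bigD1 j) //= eqxx.
by rewrite big1 ?addr0 // => x /negPf->.
Qed.

Lemma card_meet_coset A i j : (0 < n)%N ->
  #|A :&: one_coset i j|%:R = (n.-1`!)%:R * coset_mean (ind A) i j.
Proof.
move=> n0; have nf : n`! = (n * n.-1`!)%N by rewrite -{1 2}(prednK n0) factS.
rewrite -mean_ind /coset_mean nf natrM [RHS]mulrCA mulrA; congr (_ * _).
by apply: eq_mean => s; rewrite /ind !inE -natrM mulnb.
Qed.

End CosetCounting.

Lemma card_one_coset n (i j : 'I_n) : (0 < n)%N -> #|one_coset i j| = n.-1`!.
Proof.
move=> n0; apply/eqP; rewrite -(eqr_nat rat) -[one_coset i j]setTI card_meet_coset //.
rewrite /coset_mean (eq_mean (H := fun s => (s i == j)%:R)) => [|s].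
  by rewrite mean_value_eq mulr1.
by rewrite /ind inE mul1r.
Qed.

Lemma card_meet_cosets n (p q : 'I_n * 'I_n) : (2 < n)%N -> p != q ->
  (#|one_coset p.1 p.2 :&: one_coset q.1 q.2| <= n.-2`!)%N.
Proof.
case: p q => [i j] [k m] n2 /= pq.
have [ik|ik] := eqVneq i k.
  rewrite eq_card0 // => s; rewrite !inE -ik; apply/andP => -[/eqP sj /eqP sm].
  by move: pq; rewrite -ik -sj sm eqxx.
have [jm|jm] := eqVneq j m.
  rewrite eq_card0 // => s; rewrite !inE -jm; apply/andP => -[/eqP si /eqP sk].
  by move: ik; rewrite -(inj_eq (@perm_inj _ s)) si sk eqxx.
have := mean_pair_value (R := rat) (phi := fun x y => (x == j)%:R * (y == m)%:R) ik.
have mE : mean (fun s : 'S_n => (s i == j)%:R * (s k == m)%:R) =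
          mean (ind (R := rat) (one_coset i j :&: one_coset k m)).
  by apply: eq_mean => s; rewrite /ind !inE -natrM mulnb.
rewrite mE => /(_ _) e; rewrite -(ler_nat rat) -mean_ind.
have {}e : n%:R * (n%:R - 1) * mean (ind (R := rat) (one_coset i j :&: one_coset k m)) = 1 :> rat.
  rewrite e => [|x]; last by rewrite -natrM mulnb; case: eqP => // ->; rewrite (negPf jm).
  rewrite (bigD1 j) //= (bigD1 m) //= !eqxx mulr1.
  rewrite big1 ?addr0 => [|y /negPf->]; last by rewrite mulr0.
  by rewrite big1 ?addr0 // => x /negPf xj; rewrite big1 // => y _; rewrite xj mul0r.
have nf : n`! = (n * n.-1 * n.-2`!)%N.
  by case: (n) n2 => [//|[//|r]] _; rewrite !factS mulnA.
have n1 : n.-1%:R = n%:R - 1 :> rat by rewrite -subn1 natrB // (ltn_trans _ n2).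
by rewrite nf !natrM n1 mulrAC e mul1r.
Qed.

(** A point lying in several of the sets is overcounted on the left; fixing
    one of them, the others are accounted for by intersections with it. *)
Lemma union_bound_excess (I T : finType) (M : {set I}) (F : I -> {set T}) :
  (\sum_(p in M) #|F p| <= #|\bigcup_(p in M) F p| +
     \sum_(p in M) \sum_(q in M | q != p) #|F p :&: F q|)%N.
Proof.
have cE (S : {set T}) : #|S| = (\sum_t (t \in S))%N.
  by rewrite -sum1_card big_mkcond; apply: eq_bigr => t _; case: (t \in S).
have -> : (\sum_(p in M) #|F p| = \sum_t \sum_(p in M) (t \in F p))%N.
  by rewrite exchange_big; apply: eq_bigr => p _; rewrite cE.
have -> : (\sum_(p in M) \sum_(q in M | q != p) #|F p :&: F q| =
           \sum_t \sum_(p in M) \sum_(q in M | q != p) (t \in F p :&: F q))%N.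
  rewrite exchange_big; apply: eq_bigr => p _.
  by rewrite exchange_big; apply: eq_bigr => q _; rewrite cE.
rewrite cE -big_split /=.
apply: leq_sum => t _.
have [/existsP[p0 /andP[Mp0 tp0]]|noP] := boolP [exists p, (p \in M) && (t \in F p)].
  rewrite (_ : (t \in \bigcup_(p in M) F p) = true); last first.
    by apply/bigcupP; exists p0.
  rewrite [leqLHS](bigD1 p0) //= tp0 leq_add2l.
  rewrite [leqRHS](bigD1 p0) //=; apply: leq_trans (leq_addr _ _).
  by apply: leq_sum => q _; rewrite inE tp0.
rewrite big1 // => p Mp; apply/eqP; rewrite eqb0; apply: contra noP => tp.
by apply/existsP; exists p; rewrite Mp.
Qed.

(** * The edge boundary as a Dirichlet form *)

Section Boundary.
Context {R : realFieldType} {n : nat}.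

(** Each boundary edge once: it is directed from [A] to its complement, and its
    transposition is represented by an increasing pair of positions. *)
Definition boundary_arcs (A : {set 'S_n}) : {set 'S_n * ('I_n * 'I_n)} :=
  [set x : 'S_n * ('I_n * 'I_n) |
    [&& (x.2.1 < x.2.2)%N, x.1 \in A & (tperm x.2.1 x.2.2 * x.1)%g \notin A]].

Lemma card_boundary_arcs (A : {set 'S_n}) :
  (#|boundary_arcs A| <= #|edge_boundary (@transposition_graph n) A|)%N.
Proof.
pose e (x : 'S_n * ('I_n * 'I_n)) := [set x.1; (tperm x.2.1 x.2.2 * x.1)%g].
rewrite -(card_in_imset (f := e)).
  apply/subset_leq_card/subsetP => x /imsetP[[s [i k]]].
  rewrite inE /= => /and3P[ik sA tsA] ->.
  apply/imset2P; exists s (tperm i k * s)%g => //.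
  rewrite !inE tsA; apply/existsP; exists (tperm i k ^ s)%g.
  rewrite -conjgC eqxx andbT tpermJ; apply/imsetP; exists (s i, s k) => //.
  by rewrite inE /= (inj_eq perm_inj); apply: contraTneq ik => ->; rewrite ltnn.
move=> [s [i k]] [s' [i' k']]; rewrite !inE /e /=.
move=> /and3P[ik sA tA] /and3P[ik' sA' tA'] ee.
have ss' : s = s'.
  have : s \in [set s; (tperm i k * s)%g] by rewrite !inE eqxx.
  rewrite ee !inE => /orP[/eqP//|/eqP st].
  by rewrite -st sA in tA'.
have tt' : tperm i k = tperm i' k'.
  apply: (mulIg s).
  have : (tperm i k * s)%g \in [set s; (tperm i k * s)%g] by rewrite !inE eqxx orbT.
  rewrite ee !inE => /orP[/eqP ts|/eqP ->]; last by rewrite ss'.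
  by rewrite ts sA' in tA.
have : tperm i' k' i = k by rewrite -tt' tpermL.
rewrite -ss'; case: tpermP => [ii' kk'|ik'E kE|_ _ ikE].
- by rewrite ii' kk'.
- by move: ik ik'; rewrite ik'E -kE => /ltn_trans h /h; rewrite ltnn.
- by move: ik; rewrite ikE ltnn.
Qed.

Lemma dirichlet_ind_le (A : {set 'S_n}) :
  (n`!)%:R * dirichlet (ind (R := R) A) <=
  4 * #|edge_boundary (@transposition_graph n) A|%:R.
Proof.
pose out i k s : R := (s \in A)%:R * ((tperm i k * s)%g \notin A)%:R.
have out_sym i k s : out k i s = out i k s by rewrite /out tpermC.
have -> : dirichlet (ind A) = 2 * dmean out.
  rewrite mulr_natl mulr2n -[X in _ = X + _]dmean_tperm -dmeanD.
  apply: eq_dmean => i k s; rewrite /ind /out mulgA tperm2 mul1g.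
  by case: (s \in A); case: (_ \in A); rewrite /=; ring.
have -> : (n`!)%:R * (2 * dmean out) = 2 * \sum_s \sum_i \sum_k out i k s.
  by rewrite /dmean /mean mulrCA mulVKf // gt_eqF // natr_fact_gt0.
have -> : \sum_s \sum_i \sum_k out i k s =
          2 * \sum_s \sum_(i : 'I_n) \sum_(k : 'I_n | (i < k)%N) out i k s.
  rewrite mulr_sumr; apply: eq_bigr => s _.
  have -> : \sum_i \sum_k out i k s = \sum_(i : 'I_n) \sum_(k : 'I_n | (i < k)%N) out i k s
                                  + \sum_(i : 'I_n) \sum_(k : 'I_n | (k < i)%N) out i k s.
    rewrite -big_split; apply: eq_bigr => i _ /=.
    rewrite (bigID (fun k : 'I_n => (i < k)%N)) /=; congr (_ + _).
    rewrite (bigD1 i) ?ltnn //= {1}/out tperm1 mul1g.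
    rewrite -natrM mulnb andbN add0r; apply: eq_bigl => k.
    by rewrite -leqNgt ltn_neqAle andbC -(inj_eq val_inj).
  rewrite [X in _ + X](exchange_big_dep predT) //= mulr_natl mulr2n; congr (_ + _).
  by apply: eq_bigr => i _; apply: eq_bigr => k _.
rewrite mulrA -natrM ler_pM2l ?ltr0n //.
apply: le_trans (_ : #|boundary_arcs A|%:R <= _); last by rewrite ler_nat card_boundary_arcs.
have -> : #|boundary_arcs A|%:R = \sum_(s : 'S_n) \sum_(i : 'I_n) \sum_(k : 'I_n)
    ((s, (i, k)) \in boundary_arcs A)%:R :> R.
  rewrite (eq_bigr (fun s => \sum_(x : 'I_n * 'I_n)
    ((s, x) \in boundary_arcs A)%:R)); last first.
    by move=> s _; rewrite pair_bigA; apply: eq_bigr => -[].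
  rewrite pair_bigA -sum1_card natr_sum big_mkcond.
  by apply: eq_bigr => -[s x] _ /=; case: (_ \in _).
rewrite le_eqVlt; apply/orP; left; apply/eqP; apply: eq_bigr => s _.
apply: eq_bigr => i _; rewrite big_mkcond; apply: eq_bigr => k _.
rewrite inE /out /=; case: (i < k)%N => //=.
by rewrite -natrM mulnb.
Qed.

End Boundary.

(** * Stability *)

(** Since [b^2 (1 - b^2)] is at least half the distance from [b^2] to the nearer
    of 0 and 1, the number of entries with [b^2 >= 1/2] differs from the sum of
    the [b^2], hence from [c], by less than 1. *)
Lemma rounding (R : realFieldType) (I : finType) (b : I -> R) (c : nat) (err : R) :
  (forall i, - 2^-1 <= b i <= 1) ->
  \sum_i b i ^+ 2 - \sum_i b i ^+ 4 <= err ->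
  c%:R - err <= \sum_i b i ^+ 2 <= c%:R -> 3 * err < 1 ->
  exists M : {set I}, #|M| = c /\ c%:R - 3 * err <= \sum_(i in M) b i.
Proof.
move=> bP b24 /andP[Xge Xle] err1.
have b2 i : b i ^+ 2 <= 1.
  have /andP[b_ge b_le] := bP i.
  have := mulr_ge0 (_ : 0 <= 1 - b i) (_ : 0 <= b i + 2^-1).
  by rewrite subr_ge0 -lerBlDr sub0r => /(_ b_le b_ge); lra.
pose M := [set i | 2^-1 <= b i ^+ 2]; exists M.
pose defect i := if i \in M then 1 - b i ^+ 2 else b i ^+ 2.
have sum_defect : \sum_i defect i <= 2 * err.
  apply: le_trans (_ : 2 * (\sum_i b i ^+ 2 - \sum_i b i ^+ 4) <= _); last first.
    by rewrite ler_pM2l.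
  rewrite -sumrB mulr_sumr; apply: ler_sum => i _.
  have -> : b i ^+ 4 = b i ^+ 2 * b i ^+ 2 by rewrite -exprD.
  rewrite /defect inE; move: (b2 i) (sqr_ge0 (b i)); move: (b i ^+ 2) => x x1 x0.
  have [x2|x2] := leP 2^-1 x.
    have := mulr_ge0 (_ : 0 <= 1 - x) (_ : 0 <= x - 2^-1).
    by rewrite !subr_ge0 => /(_ x1 x2); lra.
  have := mulr_ge0 x0 (_ : 0 <= 2^-1 - x).
  by rewrite subr_ge0 => /(_ (ltW x2)); lra.
have card_M : #|M|%:R = \sum_i (i \in M)%:R :> R.
  by rewrite -sum1_card natr_sum big_mkcond; apply: eq_bigr => i _; case: (i \in M).
have M_le : #|M|%:R <= \sum_i b i ^+ 2 + \sum_i defect i.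
  rewrite card_M -big_split; apply: ler_sum => i _ /=.
  by rewrite /defect; have := sqr_ge0 (b i); case: (i \in M) => /=; lra.
have M_ge : \sum_i b i ^+ 2 - \sum_i defect i <= #|M|%:R.
  rewrite card_M -sumrB; apply: ler_sum => i _ /=.
  by rewrite /defect; have := b2 i; case: (i \in M) => /=; lra.
split.
  have le_c : (#|M| < c.+1)%N by rewrite -(ltr_nat R) -natr1; lra.
  have ge_c : (c < #|M|.+1)%N by rewrite -(ltr_nat R) -natr1; lra.
  by apply/eqP; rewrite eqn_leq -ltnS le_c.
apply: le_trans (_ : \sum_i b i ^+ 2 - \sum_i defect i <= _); first by lra.
rewrite [leRHS]big_mkcond -sumrB; apply: ler_sum => i _ /=.
rewrite /defect inE; have [x2|_] := leP 2^-1 (b i ^+ 2); last by rewrite subrr.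
have /andP[b_ge b_le] := bP i.
have [b0|b0] := leP 0 (b i); last by nra.
by have := mulr_ge0 b0 (_ : 0 <= 1 - b i); rewrite subr_ge0 => /(_ b_le); lra.
Qed.

Section BooleanCase.
Context {R : realFieldType} {n : nat}.
Variables (c : nat) (A : {set 'S_n}).
Hypotheses (n_gt2 : (2 < n)%N) (c_gt0 : (0 < c)%N) (c_small : (2 * c <= n)%N)
           (cardA : #|A| = (c * n.-1`!)%N).

Let N : R := n%:R.
Let C : R := c%:R.
Let N3 : 3 <= N. Proof. by rewrite ler_nat. Qed.
Let C1 : 1 <= C. Proof. by rewrite ler1n. Qed.
Let CN : 2 * C <= N. Proof. by rewrite -natrM ler_nat. Qed.
Let N0 : 0 < N. Proof. by have := N3; lra. Qed.
Let Nn0 : N != 0. Proof. exact: lt0r_neq0 N0. Qed.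
Let nf : n`! = (n * n.-1`!)%N.
Proof. by case: (n) n_gt2 => [//|m] _; rewrite factS. Qed.
Let F0 : 0 < n.-1`!%:R :> R. Proof. exact: natr_fact_gt0. Qed.

Definition centred s : R := ind A s - c%:R / n%:R.
Definition energy : R := \sum_i \sum_j coset_mean centred i j ^+ 2.
Definition energy4 : R := \sum_i \sum_j coset_mean centred i j ^+ 4.

Let mean_indA : mean (ind A) = C / N.
Proof.
apply: (mulfI (lt0r_neq0 (natr_fact_gt0 (n := n)))).
rewrite mean_ind cardA nf !natrM -/N -/C; field; exact: Nn0.
Qed.

Let mean_centred : mean centred = 0.
Proof. by rewrite meanB mean_indA mean_cst subrr. Qed.

Lemma coset_mean_centred i j :
  coset_mean centred i j = coset_mean (ind A) i j - C / N.
Proof.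
rewrite /coset_mean (eq_mean (H := fun s =>
    ind A s * (s i == j)%:R - C / N * (s i == j)%:R)).
  by rewrite meanB meanZ mulrBr [_ * (_ / _ * _)]mulrCA mean_value_eq mulr1.
by move=> s; rewrite /centred mulrBl.
Qed.

Lemma coset_mean_centred_bounds i j : - 2^-1 <= coset_mean centred i j <= 1.
Proof.
have half : C / N <= 2^-1 by rewrite ler_pdivrMr //; have := CN; lra.
have CN0 : 0 <= C / N by rewrite divr_ge0 ?ler0n.
have ge0 : 0 <= coset_mean (ind A) i j :> R.
  by rewrite /coset_mean mulr_ge0 ?ler0n //; apply: mean_ge0 => s; rewrite mulr_ge0 ?ler0n.
have le1 : coset_mean (ind A) i j <= 1 :> R.
  rewrite -(ler_pM2l F0) -card_meet_coset ?(ltn_trans _ n_gt2) // mulr1 ler_nat.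
  rewrite -(card_one_coset i j) ?(ltn_trans _ n_gt2) //.
  by rewrite subset_leq_card // subsetIr.
by rewrite coset_mean_centred; apply/andP; split; lra.
Qed.

Let mean_centred2 : mean (fun s => centred s ^+ 2) = C / N * (1 - C / N).
Proof.
rewrite (eq_mean (H := fun s => (1 - 2 * (C / N)) * ind A s + (C / N) ^+ 2)).
  by rewrite meanD meanZ mean_cst mean_indA; ring.
by move=> s; rewrite /centred /ind -/N -/C; case: (s \in A) => /=; ring.
Qed.

Lemma energy_le : (N - 1) * energy <= C * (N - C).
Proof.
have := coset_mean_bessel (ltnW n_gt2) mean_centred.
rewrite mean_centred2 -/energy -/N => le1.
have N2 : 0 <= N ^+ 2 by apply: sqr_ge0.
have := ler_wpM2l N2 le1.
rewrite [N ^+ 2 * (_ / _ * _)](_ : _ = (N - 1) * energy); last by field; exact: Nn0.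
by rewrite [N ^+ 2 * _](_ : _ = C * (N - C)) //; field; exact: Nn0.
Qed.

Lemma energy_ge (delta : R) :
  #|edge_boundary (@transposition_graph n) A|%:R <=
    #|A|%:R * ((n`!)%:R - #|A|%:R) / ((n.-1)`!)%:R + delta * n%:R * #|A|%:R ->
  C * ((N - C) * (N - 2) - delta * N ^+ 2) <= (N - 1) * (N - 2) * energy.
Proof.
move=> bd; have dE : dirichlet (ind (R := R) A) = dirichlet centred.
  by apply: eq_dmean => i k s; rewrite /centred; ring.
have gap : 8 * (N - 1) * (C / N * (1 - C / N))
    - 4 * (N - 2) * ((N - 1) / N ^+ 2 * energy) <= dirichlet centred.
  rewrite -mean_centred2; have := mean_centred; have := n_gt2.
  rewrite /energy /N; case: (n) (centred) => [//|[//|m]] g _ g0.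
  apply: level_one_reduction => // h; exact: second_level_gap.
have bd4 : 4 * #|edge_boundary (@transposition_graph n) A|%:R <=
           4 * (C * n.-1`!%:R * (N - C + delta * N)).
  rewrite ler_pM2l //; apply: le_trans bd _; rewrite cardA nf !natrM -/N -/C.
  by rewrite le_eqVlt; apply/orP; left; apply/eqP; field; apply: lt0r_neq0.
have up : N * dirichlet centred <= 4 * (C * (N - C + delta * N)).
  have := le_trans (dirichlet_ind_le A) bd4.
  rewrite nf natrM dE -/N => up; rewrite -(ler_pM2l F0); move: up; lra.
have := ler_wpM2l (ltW N0) (le_trans (ler_wpM2l (ltW N0) gap) up).
have -> : N * (N * (8 * (N - 1) * (C / N * (1 - C / N))
    - 4 * (N - 2) * ((N - 1) / N ^+ 2 * energy))) =
   8 * (N - 1) * C * (N - C) - 4 * (N - 2) * (N - 1) * energy.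
  by field; exact: Nn0.
lra.
Qed.

(** [G^4 - 4 G + 3 = (G - 1)^2 ((G + 1)^2 + 2)] is nonnegative, which bounds
    the fourth moment below by a correlation with the 0-1 valued indicator. *)
Lemma energy4_ge : 4 * energy - 3 * C <= energy4 + 308 * energy ^+ 2 / N.
Proof.
pose G := permstat (coset_mean centred).
have bb := coset_mean_balanced mean_centred.
apply: le_trans (permstat_fourth_moment (ltnW n_gt2) bb).
have G1 : N * mean (fun s => ind A s * G s) = energy.
  rewrite (eq_mean (H := fun s => centred s * G s + C / N * G s)) => [|s]; last first.
    by rewrite /centred; ring.
  rewrite meanD meanZ mean_permstat_balanced // mulr0 addr0 mean_mul_permstat.
  by do 2![apply: eq_bigr => ? _]; rewrite expr2.
have -> : 4 * energy - 3 * C = N * mean (fun s => 4 * (ind A s * G s) + - 3 * ind A s).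
  by rewrite meanD !meanZ mean_indA -G1; field; exact: Nn0.
rewrite ler_pM2l //; apply: ler_mean => s; rewrite -/(G s) /ind.
have G4 : 0 <= (G s - 1) ^+ 2 * ((G s + 1) ^+ 2 + 2).
  by rewrite mulr_ge0 ?addr_ge0 ?sqr_ge0.
case: (s \in A) => /=; first by lra.
by rewrite mul0r !mulr0 addr0 (exprM _ 2 2) sqr_ge0.
Qed.

(** For [c] entries carrying the mass [c - t], the cosets miss at most [t (n-1)!]
    elements of [A], and at most [(n-2)!] more for each ordered pair of cosets. *)
Lemma union_of_dense_cosets (M : {set 'I_n * 'I_n}) (t : R) :
  #|M| = c -> C - t <= \sum_(p in M) coset_mean centred p.1 p.2 ->
  exists B : {set 'S_n}, union_of_one_cosets c B /\
    #|A :\: B|%:R <= t * (n.-1`!)%:R + C ^+ 2 * (n.-2`!)%:R.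
Proof.
move=> cM Mt; pose T (p : 'I_n * 'I_n) := one_coset p.1 p.2.
have n1 : (n.-2`! < n.-1`!)%N.
  case: (n) n_gt2 => [//|[//|[//|m]]] _ /=.
  by rewrite [ltnRHS]factS ltn_Pmull ?fact_gt0.
have T_card p : #|T p| = n.-1`! by rewrite card_one_coset // (ltn_trans _ n_gt2).
have T_inj : injective T.
  move=> p q Tpq; apply/eqP; apply: contraLR n1 => pq.
  rewrite -leqNgt -(T_card p) -[T p]setIid {2}Tpq.
  exact: card_meet_cosets.
exists (cover (T @: M)); split.
  exists (T @: M); split=> //; last by rewrite card_imset.
  apply/subsetP => _ /imsetP[[i j] _ ->]; apply/imset2P.
  by exists i j.
rewrite cover_imset.
pose U := \bigcup_(p in M) T p.
have excess : \sum_(p in M) #|A :&: T p|%:R <=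
              #|A :&: U|%:R + C ^+ 2 * (n.-2`!)%:R :> R.
  rewrite -natr_sum -natrX -natrM -natrD ler_nat.
  apply: leq_trans (union_bound_excess M (fun p => A :&: T p)) _.
  apply: leq_add; first by rewrite -big_distrr.
  apply: leq_trans (_ : \sum_(p in M) \sum_(q in M) n.-2`! <= _)%N.
    apply: leq_sum => p _; rewrite big_mkcondr /=; apply: leq_sum => q _.
    case: ifP => // qp; rewrite eq_sym in qp.
    apply: leq_trans (card_meet_cosets n_gt2 qp).
    by apply/subset_leq_card/setISS; apply: subsetIr.
  by rewrite !sum_nat_const cM mulnA.
have cut : #|A :\: U|%:R = #|A|%:R - #|A :&: U|%:R :> R.
  by rewrite -(cardsID U A) natrD addrC addKr.
have mass : (C - t) * n.-1`!%:R <= \sum_(p in M) #|A :&: T p|%:R.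
  rewrite (eq_bigr (fun p => n.-1`!%:R * coset_mean (ind A) p.1 p.2)); last first.
    by move=> p _; rewrite card_meet_coset // (ltn_trans _ n_gt2).
  rewrite -mulr_sumr mulrC ler_pM2l //; apply: le_trans Mt _.
  apply: ler_sum => p _; rewrite coset_mean_centred gerBl.
  by rewrite divr_ge0 ?ler0n.
rewrite cut cardA natrM -/C; move: excess mass; lra.
Qed.

Lemma boundary_stability (d : R) : 0 <= d ->
  #|edge_boundary (@transposition_graph n) A|%:R <=
    #|A|%:R * ((n`!)%:R - #|A|%:R) / ((n.-1)`!)%:R + d * n%:R * #|A|%:R ->
  45 * (C * d) + 942 * (C ^+ 2 / N) < 1 ->
  exists B : {set 'S_n}, union_of_one_cosets c B /\
    #|A :\: B|%:R <= 45 * (C * d) * (n.-1`!)%:R + 943 * C ^+ 2 * (n.-2`!)%:R.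
Proof.
move=> d0 /energy_ge ge small; pose X := energy; pose K := C ^+ 2 / N.
have K0 : 0 <= K by rewrite divr_ge0 ?sqr_ge0 // ltW.
have NK : N * K = C ^+ 2 by rewrite /K mulrC divfK.
have N1 : 0 < N - 1 by have := N3; lra.
have N2 : 0 < N - 2 by have := N3; lra.
have C0 : 0 <= C by have := C1; lra.
have Cd0 : 0 <= C * d by rewrite mulr_ge0.
have X_le : X <= C.
  rewrite -(ler_pM2l N1); apply: le_trans energy_le _.
  by rewrite [leRHS]mulrC ler_wpM2l //; have := C1; lra.
(* [N^2 <= 5 (N - 1) (N - 2)] as soon as [N >= 3] *)
have X_ge : C - 2 * K - 5 * (C * d) <= X.
  rewrite -(ler_pM2l (mulr_gt0 N1 N2)); apply: le_trans ge.
  have h1 : 0 <= (C * d) * (5 * ((N - 1) * (N - 2)) - N ^+ 2).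
    by rewrite mulr_ge0 //; have := mulr_ge0 (ltW N1) (ltW N2); have := N3; nra.
  have h2 : 0 <= (N - 2) * (C + C ^+ 2 - 2 * K).
    rewrite mulr_ge0 ?(ltW N2) //.
    have : 2 * K <= C.
      by rewrite /K mulrA ler_pdivrMr // expr2 mulrA [leRHS]mulrC ler_wpM2r // CN.
    by have := sqr_ge0 C; lra.
  rewrite -subr_ge0 (_ : _ - _ = (N - 2) * (C + C ^+ 2 - 2 * K)
    + (C * d) * (5 * ((N - 1) * (N - 2)) - N ^+ 2) + 2 * (N - 2) * (N * K - C ^+ 2)).
    by rewrite NK subrr mulr0 addr0 addr_ge0.
  by ring.
have X2 : X ^+ 2 / N <= K.
  rewrite ler_pM2r ?invr_gt0 // ler_sqr ?nnegrE //.
  by do 2![apply: sumr_ge0 => ? _]; apply: sqr_ge0.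
pose b (p : 'I_n * 'I_n) := coset_mean centred p.1 p.2.
pose err := 15 * (C * d) + 314 * K.
have [||||M [cM Mb]] := @rounding R _ b c err.
- by move=> p; apply: coset_mean_centred_bounds.
- rewrite -(pair_bigA _ (fun i j => coset_mean centred i j ^+ 2)).
  rewrite -(pair_bigA _ (fun i j => coset_mean centred i j ^+ 4)).
  rewrite -/energy -/energy4 /err; have := energy4_ge.
  by rewrite -mulrA; move: X_ge X2; rewrite -/X; lra.
- rewrite -(pair_bigA _ (fun i j => coset_mean centred i j ^+ 2)) -/energy.
  by apply/andP; split=> //; rewrite /err; move: X_ge; rewrite -/X; lra.
- by rewrite /err; move: small; rewrite -/K; lra.
have [B [BF le_B]] := union_of_dense_cosets cM Mb; exists B; split=> //.
apply: le_trans le_B _.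
have F12 : n.-1`!%:R <= N * n.-2`!%:R :> R.
  rewrite -natrM ler_nat; case: (n) n_gt2 => [//|[//|m]] _ /=.
  by rewrite factS leq_mul2r leqnSn orbT.
have KF : K * (N * n.-2`!%:R) = C ^+ 2 * n.-2`!%:R by rewrite mulrA [K * N]mulrC NK.
by have := ler_wpM2l K0 F12; rewrite KF /err; lra.
Qed.

End BooleanCase.

Theorem theorem3 (R : realType) :
  exists C1 C2 C3 C4 : R,
    [/\ 0 < C1, 0 < C2, 0 < C3 & 0 < C4] /\
    forall c : nat, exists (n0 : nat) (delta0 : R),
      [/\ 0 < delta0,
          C3 * (c%:R ^- 4) <= delta0,
          n0%:R <= C4 * c%:R ^+ 2 &
          forall (n : nat) (A : {set 'S_n}) (delta : R),
            (n0 <= n)%N -> delta <= delta0 ->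
            #|A| = (c * (n.-1)`!)%N ->
            #|edge_boundary (@transposition_graph n) A|%:R <=
              #|A|%:R * ((n`!)%:R - #|A|%:R) / ((n.-1)`!)%:R
              + delta * n%:R * #|A|%:R ->
            exists B : {set 'S_n},
              union_of_one_cosets c B /\
              #|A :\: B|%:R <=
                C1 * (c%:R * `|delta|) * ((n.-1)`!)%:R
                + C2 * c%:R ^+ 2 * ((n.-2)`!)%:R].
Proof.
(* [180] and [4000] make three times the error of [rounding] at most
   [45 / 180 + 942 / 4000 < 1]. *)
exists 45, 943, 180^-1, 4000; split; first by split; lra.
case=> [|c].
  exists 0%N, 1; split=> //; first by rewrite expr0n invr0 mulr0.
    by rewrite expr0n mulr0.
  move=> n A delta _ _ /eqP; rewrite cards_eq0 => /eqP -> _.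
  exists set0; split.
    by exists set0; rewrite sub0set cards0 /cover big_set0.
  by rewrite set0D cards0 mul0r mulr0 mul0r expr0n mulr0 mul0r addr0.
pose k : R := c.+1%:R; have k1 : 1 <= k by rewrite ler1n.
have k0 : 0 < k by lra.
exists (4000 * c.+1 ^ 2)%N, (180 * k)^-1; split.
- by rewrite invr_gt0; lra.
- rewrite -/k [leRHS]invfM ler_pM2l ?invr_gt0 // lef_pV2 ?posrE ?exprn_gt0 //.
  by rewrite -[leLHS]expr1 ler_weXn2l.
- by rewrite natrM natrX.
move=> n A delta nge dle cardA bd.
have n2 : (2 < n)%N by apply: leq_trans nge; rewrite (@leq_trans 4000) // leq_pmulr // expn_gt0.
have cn : (2 * c.+1 <= n)%N.
  by apply: leq_trans nge; rewrite leq_mul // expnS leq_pmulr.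
(* A negative [delta] only strengthens the hypothesis. *)
pose d := Num.max 0 delta.
have d0 : 0 <= d by rewrite le_max lexx.
have d_le : d <= (180 * k)^-1.
  by rewrite ge_max dle andbT invr_ge0; lra.
have d_abs : d <= `|delta| by rewrite ge_max normr_ge0 ler_norm.
have bd_d : #|edge_boundary (@transposition_graph n) A|%:R <=
    #|A|%:R * ((n`!)%:R - #|A|%:R) / ((n.-1)`!)%:R + d * n%:R * #|A|%:R.
  apply: le_trans bd _; rewrite lerD2l -!mulrA ler_wpM2r ?mulr_ge0 ?ler0n //.
  by rewrite le_max lexx orbT.
have n_gt0 : 0 < n%:R :> R by rewrite ltr0n (ltn_trans _ n2).
have kd : k * d <= 180^-1.
  have := ler_wpM2l (ltW k0) d_le.
  by rewrite invfM mulrCA divff ?mulr1 // gt_eqF.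
have kn : k ^+ 2 / n%:R <= 4000^-1.
  rewrite ler_pdivrMr // ler_pdivlMl // -natrX -natrM ler_nat //.
have [|B [BF le_B]] := boundary_stability n2 (ltn0Sn c) cn cardA d0 bd_d.
  by rewrite -/k; lra.
exists B; split=> //; apply: le_trans le_B _; rewrite lerD2r.
by rewrite ler_wpM2r ?ler0n // ler_pM2l // ler_wpM2l // ler0n.
Qed.
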